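(* Let $G$ be any group of matrices whose entries are computable numbers, such that $SL(4,\mathbb{Z})$ is a subgroup of $G$. Then $\mathfrak{L}(G)=\mathsf{RE}$.
   Context: For a group $G$ with identity $e$, a $G$-automaton is a tuple $(Q,\Sigma,G,\delta,q_0,Q_a)$ where $Q$ is a finite set of states, $\Sigma$ a finite input alphabet, $q_0\in Q$ the initial state, $Q_a\subseteq Q$ the accepting states, and $\delta$ assigns to each $(q,\sigma)\in Q\times(\Sigma\cup\{\varepsilon\})$ a finite set of pairs $(q',m)\in Q\times G$. The register holds an element of $G$, initially $e$; using a transition $(q',m)\in\delta(q,\sigma)$ the automaton reads $\sigma$ (or nothing), moves to $q'$ and replaces the register content $x$ by $xm$. A word is accepted if some computation reads it entirely and ends in an accepting state with register equal to $e$. $\mathfrak{L}(G)$ is the class of languages recognized by $G$-automata. $\mathsf{RE}$ is the class of recursively enumerable languages; $SL(4,\mathbb{Z})$ is the group of $4\times4$ integer matrices of determinant $1$. *)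

(* Defs.v *)
From mathcomp Require Import all_boot all_algebra.
From mathcomp Require Import reals Rstruct.
From mathcomp.real_closed Require Import complex.
From Stdlib Require List.

Set Implicit Arguments.
Unset Strict Implicit.
Unset Printing Implicit Defensive.

Import GRing.Theory Num.Theory.
Local Open Scope ring_scope.

(* Arguments are passed as a list; arities are not checked (missing    *)
(* arguments read as 0), which does not change the class of functions. *)

Inductive prf : Type :=
| PZero : prf
| PSucc : prf
| PProj : nat -> prf
| PComp : prf -> list prf -> prf
| PPrec : prf -> prf -> prf
| PMu   : prf -> prf.

Inductive prf_eval : prf -> list nat -> nat -> Prop :=
| ev_zero v : prf_eval PZero v 0
| ev_succ v : prf_eval PSucc v (List.hd 0%N v).+1
| ev_proj i v : prf_eval (PProj i) v (List.nth i v 0%N)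
| ev_comp f gs v ys y :
    prf_evals gs v ys -> prf_eval f ys y -> prf_eval (PComp f gs) v y
| ev_prec0 f g v y :
    prf_eval f v y -> prf_eval (PPrec f g) (0%N :: v) y
| ev_precS f g n v r y :
    prf_eval (PPrec f g) (n :: v) r -> prf_eval g (n :: r :: v) y ->
    prf_eval (PPrec f g) (n.+1 :: v) y
| ev_mu f v y :
    prf_eval f (y :: v) 0%N ->
    (forall z, (z < y)%N -> exists r, prf_eval f (z :: v) r.+1) ->
    prf_eval (PMu f) v y
with prf_evals : list prf -> list nat -> list nat -> Prop :=
| evs_nil v : prf_evals nil v nil
| evs_cons g gs v y ys :
    prf_eval g v y -> prf_evals gs v ys -> prf_evals (g :: gs) v (y :: ys).

Definition prf_total1 (f : prf) : Prop := forall n, exists y, prf_eval f [:: n] y.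

(* Words are coded by the standard (computable) MathComp encoding      *)
(* [pickle] of the countType [seq S].  L is r.e. iff it is the domain  *)
(* (on codes of words) of a partial recursive function.                *)

Definition RE_lang (S : finType) (L : seq S -> Prop) : Prop :=
  exists f : prf, forall w : seq S, L w <-> exists y, prf_eval f [:: pickle w] y.

Definition C := complex Rdefinitions.R.

Definition computable_real (x : Rdefinitions.R) : Prop :=
  exists a b c : prf,
    [/\ prf_total1 a, prf_total1 b, prf_total1 c &
      forall n an bn cn : nat,
        prf_eval a [:: n] an -> prf_eval b [:: n] bn -> prf_eval c [:: n] cn ->
        `| x - (an%:R - bn%:R) / (cn.+1)%:R | <= (n.+1%:R)^-1].

Definition computable_number (z : C) : Prop :=
  computable_real (complex.Re z) /\ computable_real (complex.Im z).

Definition Mat := 'M[C]_4.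

Definition matrix_group (G : Mat -> Prop) : Prop :=
  [/\ G 1%:M,
      (forall A B, G A -> G B -> G (A *m B)) &
      (forall A, G A -> A \in unitmx /\ G (invmx A))].

Definition contains_SL4Z (G : Mat -> Prop) : Prop :=
  forall A : 'M[int]_4, \det A = 1 -> G (map_mx (fun z : int => z%:~R) A).

Record gautomaton (S : finType) (G : Mat -> Prop) := GAutomaton {
  ga_state : finType;
  ga_init : ga_state;
  ga_acc : pred ga_state;
  (* None stands for the empty word epsilon *)
  ga_delta : ga_state -> option S -> list (ga_state * Mat);
  ga_deltaG : forall q a p, List.In p (ga_delta q a) -> G p.2
}.

Inductive ga_run (S : finType) (G : Mat -> Prop) (A : gautomaton S G) :
  ga_state A -> seq S -> Mat -> ga_state A -> Mat -> Prop :=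
| run_nil q x : @ga_run S G A q [::] x q x
| run_eps q q1 m w x q' x' :
    List.In (q1, m) (@ga_delta S G A q None) ->
    @ga_run S G A q1 w (x *m m) q' x' -> @ga_run S G A q w x q' x'
| run_sym q q1 m a w x q' x' :
    List.In (q1, m) (@ga_delta S G A q (Some a)) ->
    @ga_run S G A q1 w (x *m m) q' x' -> @ga_run S G A q (a :: w) x q' x'.

Definition ga_accepts (S : finType) (G : Mat -> Prop) (A : gautomaton S G)
  (w : seq S) : Prop :=
  exists qf, @ga_acc S G A qf /\ @ga_run S G A (@ga_init S G A) w 1%:M qf 1%:M.

Definition in_LG (G : Mat -> Prop) (S : finType) (L : seq S -> Prop) : Prop :=
  exists A : gautomaton S G, forall w, L w <-> ga_accepts A w.

(* Main.v *)
Require Import Defs.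
From HB Require Import structures.
From mathcomp Require Import all_boot all_algebra.
From mathcomp Require Import reals Rstruct.
From mathcomp.real_closed Require Import complex.
From mathcomp Require Import zify.
From Stdlib Require Import FunctionalExtensionality Classical.

Set Implicit Arguments.
Unset Strict Implicit.
Unset Printing Implicit Defensive.

Import GRing.Theory Num.Theory.

(** Recursively enumerable languages are recognized because SL(4,Z) contains
    SL(2,Z) x SL(2,Z), hence the product of two free monoids: an automaton can
    write two words independently and require that they be equal at the end.
    Letting one be the word of letters put into a queue and the other the word
    of letters taken out of it, the automaton simulates a queue machine, hence
    counters, hence any partial recursive function.

    Conversely the word problem of finitely many complex matrices is decidable.
    Their entries generate a finitely generated field, finite over Q(t) with t
    algebraically independent, so that the matrices act on a finite-dimensional
    Q(t)-space by matrices N / q over Z[t].  A word of length c gives polynomials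
    in t whose degrees and coefficients are bounded in terms of c; they vanish
    if and only if they vanish at integers growing fast enough, and this is a
    recursive condition.  The finite data t, N, q are fixed with the automaton
    and need not be computed from it. *)

(** * Rational expressions *)

(** The automaton cannot inspect its register, so each removal from the queue is a guess, and a
    wrong guess shows only in the final comparison of the two words. A queue run is therefore
    analysed under the assumption that both words can still be completed to equal ones, an
    assumption inherited by earlier points of the run because the words only grow. Queue and
    register programs alike are rational expressions with a relational semantics; each is carried to
    the level below by substituting an expression for every label, and a finite control is built
    only once.

    In the converse, division is avoided: a word of matrices N / q is the identity when the product
    of its numerators is the scalar q raised to the length of the word, an equation in Z[t]. An
    algebraic entry z is eliminated by adjoining multiples by powers of z to the rows acted upon.
    This may create dependent rows, so a smallest family is chosen afterwards, for which the
    criterion is exact. Integers may replace t because a nonzero polynomial has no root beyond a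
    bound read off its coefficients. *)

Section Rational.
Variable S : Type.

Section Expressions.
Variable Lab : Type.

Inductive rexp : Type :=
| Eps
| Atom of Lab
| Seq of rexp & rexp
| Alt of rexp & rexp
| Star of rexp.

Section Execution.
Variable X : Type.

Inductive star (R : seq S -> X -> X -> Prop) : seq S -> X -> X -> Prop :=
| star_nil x : star R [::] x x
| star_cons w1 w2 x y z : R w1 x y -> star R w2 y z -> star R (w1 ++ w2) x z.

Variable step : Lab -> seq S -> X -> X -> Prop.

Fixpoint exec (p : rexp) (w : seq S) (x y : X) : Prop :=
  match p with
  | Eps => w = [::] /\ x = y
  | Atom l => step l w x y
  | Seq p q => exists w1 w2 z, [/\ w = w1 ++ w2, exec p w1 x z & exec q w2 z y]
  | Alt p q => exec p w x y \/ exec q w x y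
  | Star p => star (exec p) w x y
  end.

Lemma star_sub (R R' : seq S -> X -> X -> Prop) w x y :
  (forall w x y, R w x y -> R' w x y) -> star R w x y -> star R' w x y.
Proof.
move=> RR'; elim=> [z|w1 w2 a b c /RR' r _]; first exact: star_nil.
exact: star_cons.
Qed.
End Execution.
End Expressions.

Fixpoint bind (L1 L2 : Type) (f : L1 -> rexp L2) (p : rexp L1) : rexp L2 :=
  match p with
  | Eps => Eps L2
  | Atom l => f l
  | Seq p q => Seq (bind f p) (bind f q)
  | Alt p q => Alt (bind f p) (bind f q)
  | Star p => Star (bind f p)
  end.
End Rational.
Arguments Eps {Lab}.

(** * Kleene's theorem: from expressions over matrix labels to automata *)

Section Kleene.
Local Open Scope ring_scope.
Variables (S : finType) (G : Mat -> Prop) (Lab : eqType).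
Variables (lw : Lab -> option S) (lm : Lab -> Mat).
Hypothesis G1 : G 1%:M.
Hypothesis lmG : forall l, G (lm l).

Definition mstep (l : Lab) (w : seq S) (x y : Mat) : Prop :=
  w = seq_of_opt (lw l) /\ y = (x *m lm l).

Lemma rexp_eq_dec (p q : rexp Lab) : {p = q} + {p <> q}.
Proof. by decide equality; apply: eq_comparable. Qed.

HB.instance Definition _ := hasDecEq.Build (rexp Lab) (compareP rexp_eq_dec).

(* A state is the list of expressions still to be executed. *)
Definition succ (k : seq (rexp Lab)) (a : option S) : seq (seq (rexp Lab) * Mat) :=
  match k with
  | [::] => [::]
  | Atom l :: k => if lw l == a then [:: (k, lm l)] else [::]
  | p :: k =>
    if a is Some _ then [::] else
    [seq (i, 1%:M) | i <- match p with
      | Seq p q => [:: p :: q :: k]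
      | Alt p q => [:: p :: k; q :: k]
      | Star p => [:: k; p :: Star p :: k]
      | _ => [:: k]
      end]
  end.

(** The states met before only the continuation [k] remains. They are finitely many because the body
    of a star runs with continuation [Star p :: k], itself one of these states. *)
Fixpoint reach (p : rexp Lab) (k : seq (rexp Lab)) : seq (seq (rexp Lab)) :=
  (p :: k) :: match p with
    | Seq p q => reach p (q :: k) ++ reach q k
    | Alt p q => reach p k ++ reach q k
    | Star p => reach p (Star p :: k)
    | _ => [::]
    end.

Lemma mem_reach p k : p :: k \in reach p k.
Proof. by case: p => *; rewrite /= mem_head. Qed.

Lemma reach_succ p k s a t : s \in reach p k -> List.In t (succ s a) ->
  t.1 \in k :: reach p k.
Proof.
elim: p k s a t => [|l|p IHp q IHq|p IHp q IHq|p IHp] k s a t /=.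
- rewrite inE => /eqP->; case: a => //= [[<-|//]].
  by rewrite mem_head.
- rewrite inE => /eqP-> /=; case: ifP => //= _ [<-|//].
  by rewrite mem_head.
- rewrite inE => /orP[/eqP->|].
    case: a => //= [[<-|//]] /=.
    by rewrite !inE mem_cat mem_reach !orbT.
  rewrite mem_cat => /orP[/IHp ip /ip|/IHq iq /iq].
    rewrite !inE mem_cat => /orP[/eqP->|->]; last by rewrite !orbT.
    by rewrite mem_reach !orbT.
  by rewrite !inE mem_cat => /orP[->|->]; rewrite ?orbT.
- rewrite inE => /orP[/eqP->|].
    case: a => //= [[<-|[<-|//]]] /=.
      by rewrite !inE mem_cat mem_reach !orbT.
    by rewrite !inE mem_cat mem_reach !orbT.
  rewrite mem_cat => /orP[/IHp ip /ip|/IHq iq /iq].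
    by rewrite !inE mem_cat => /orP[->|->]; rewrite ?orbT.
  by rewrite !inE mem_cat => /orP[->|->]; rewrite ?orbT.
- rewrite inE => /orP[/eqP->|].
    case: a => //= [[<-|[<-|//]]] /=.
      by rewrite mem_head.
    by rewrite !inE mem_reach !orbT.
  move=> /IHp ip /ip.
  by rewrite !inE => /orP[->|->]; rewrite ?orbT.
Qed.

Inductive krun : seq (rexp Lab) -> seq S -> Mat -> Mat -> Prop :=
| krun_nil x : krun [::] [::] x x
| krun_step k k' m a w x x' : List.In (k', m) (succ k a) ->
    krun k' w (x *m m) x' -> krun k (seq_of_opt a ++ w) x x'.

Fixpoint kexec (k : seq (rexp Lab)) (w : seq S) (x y : Mat) : Prop :=
  if k is p :: k then
    exists w1 w2 z, [/\ w = w1 ++ w2, exec mstep p w1 x z & kexec k w2 z y]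
  else w = [::] /\ x = y.

Lemma krun_kexec k w x y : krun k w x y -> kexec k w x y.
Proof.
elim=> {k w x y} // k k' m a w x x'.
case: k => [|[|l|p q|p q|p] k] //=.
- case: a => //= [[[<- <-]|//]] _.
  by rewrite mulmx1 => kw; exists [::], w, x.
- case: ifP => //= /eqP<- [[<- <-]|//] _ kw.
  by exists (seq_of_opt (lw l)), w, (x *m lm l).
- case: a => //= [[[<- <-]|//]] _ /=.
  rewrite mulmx1 => -[w1 [w2 [z [-> pw [w3 [w4 [z' [-> qw kw]]]]]]]].
  exists (w1 ++ w3), w4, z'; split=> //; first by rewrite catA.
  by exists w1, w3, z.
- case: a => //= [[[<- <-]|[[<- <-]|//]]] _ /=;
  rewrite mulmx1 => -[w1 [w2 [z [-> pw kw]]]]; exists w1, w2, z; split=> //.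
    by left.
  by right.
- case: a => //= [[[<- <-]|[[<- <-]|//]]] _ /=; rewrite mulmx1.
    by move=> kw; exists [::], w, x; split=> //; apply: star_nil.
  move=> [w1 [w2 [z [-> pw [w3 [w4 [z' [-> qw kw]]]]]]]].
  exists (w1 ++ w3), w4, z'; split=> //; first by rewrite catA.
  exact: star_cons pw qw.
Qed.

Lemma krun_eps k k' w x x' : List.In (k', 1%:M) (succ k None) ->
  krun k' w x x' -> krun k w x x'.
Proof.
move=> kk' r.
by apply: (@krun_step _ _ _ None w _ _ kk'); rewrite mulmx1.
Qed.

Lemma exec_krun p k w1 w2 x y z :
  exec mstep p w1 x z -> krun k w2 z y -> krun (p :: k) (w1 ++ w2) x y.
Proof.
elim: p k w1 w2 x y z => [|l|p IHp q IHq|p IHp q IHq|p IHp] k w1 w2 x y z /=.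
- by move=> [-> <-]; apply: krun_eps; left.
- by move=> [-> ->]; apply: krun_step; rewrite /= eqxx; left.
- move=> [w3 [w4 [u [-> pw qw]]]] kw; rewrite -catA.
  apply: (@krun_eps _ (p :: q :: k)); first by left.
  by apply: IHp pw _; apply: IHq qw _.
- move=> [pw|qw] kw.
    by apply: (@krun_eps _ (p :: k)); [left | apply: IHp pw _].
  by apply: (@krun_eps _ (q :: k)); [right; left | apply: IHq qw _].
- move=> st; elim: st y => [u|v1 v2 u1 u2 u3 pw _ IH] y kw.
    by apply: (@krun_eps _ k) => //; left.
  rewrite -catA; apply: (@krun_eps _ (p :: Star p :: k)); first by right; left.
  by apply: IHp pw _; apply: IH.
Qed.

Lemma krunE p w x y : krun [:: p] w x y <-> exec mstep p w x y.
Proof.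
split=> [/krun_kexec|pw].
  by move=> /= [w1 [w2 [z [-> pw [-> <-]]]]]; rewrite cats0.
by rewrite -[w]cats0; apply: exec_krun pw _; apply: krun_nil.
Qed.

Lemma succG k a t : List.In t (succ k a) -> G t.2.
Proof.
case: k => [|[|l|p q|p q|p] k] //=; case: a => [a|] //=; try case: ifP => //= _;
  by rewrite ?map_cons /=; do ?[case=> [<- //=|] //].
Qed.

Lemma rational_in_LG (p : rexp Lab) (L : seq S -> Prop) :
  (forall w, L w <-> exec mstep p w 1%:M 1%:M) -> in_LG G L.
Proof.
move=> LE; pose l := [::] :: reach p [::].
have lsucc s a t : s \in l -> List.In t (succ s a) -> t.1 \in l.
  by rewrite inE => /orP[/eqP->//|]; apply: reach_succ.
have l0 : [:: p] \in l by rewrite inE mem_reach orbT.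
pose Q : finType := adhoc_seq_sub_finType l.
pose q0 : Q := SeqSub l0.
(* The default [q] of [insubd] is never taken, since [l] is closed under [succ]. *)
pose nxt (q : Q) (t : seq (rexp Lab) * Mat) : Q * Mat := (insubd q t.1, t.2).
pose d (q : Q) (a : option S) := List.map (nxt q) (succ (val q) a).
have dG q a t : List.In t (d q a) -> G t.2.
  by rewrite /d => /List.in_map_iff[u [<- /succG]].
pose A := @GAutomaton S G Q q0 [pred q : Q | val q == [::]] d dG.
have nxtE (q : Q) a t : List.In t (succ (val q) a) -> val (nxt q t).1 = t.1.
  by move=> /(lsucc _ _ _ (valP q)) tl; rewrite insubdK.
exists A => w; rewrite LE -krunE; split.
  suff H (k0 : seq (rexp Lab)) x y : krun k0 w x y -> forall q : Q, val q = k0 ->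
      exists qf : Q, @ga_acc _ _ A qf /\ @ga_run _ _ A q w x qf y.
    by move=> kr; apply: (H _ _ _ kr q0).
  elim=> {k0 w x y} [x q qE|k k' m a w x x' kk' _ IH q qE].
    by exists q; split; [rewrite /= qE | apply: run_nil].
  have kk2 : List.In (k', m) (succ (val q) a) by rewrite qE.
  have [|qf [qa rr]] := IH (nxt q (k', m)).1; first exact: nxtE kk2.
  exists qf; split=> //.
  have di : List.In (nxt q (k', m)) (@ga_delta _ _ A q a) by apply: List.in_map.
  by case: a di {kk' kk2} => [a|] di; [apply: run_sym rr | apply: run_eps rr].
move=> [qf [/eqP qfE]].
suff H (q q' : Q) v x y : @ga_run _ _ A q v x q' y -> val q' = [::] ->
    krun (val q) v x y by move=> /H; apply.
elim=> {q q' v x y} [q x -> |q q1 m v x q' x'|q q1 m a v x q' x'].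
- exact: krun_nil.
- move=> /List.in_map_iff[[k' m'] [[<- <-] km] _ IH] qE.
  by apply: (@krun_step _ k' m' None) => //; have := IH qE; rewrite (nxtE _ _ _ km).
- move=> /List.in_map_iff[[k' m'] [[<- <-] km] _ IH] qE.
  apply: (@krun_step _ k' m' (Some a)) => //.
  by move: (nxtE _ _ _ km) (IH qE) => ->.
Qed.
End Kleene.

(** * Free monoids in SL(4,Z) *)

Section ExecTheory.
Variable S : Type.

Lemma exec_bind (L1 L2 X : Type) (f : L1 -> rexp L2)
    (step : L2 -> seq S -> X -> X -> Prop) p w x y :
  exec step (bind f p) w x y <-> exec (fun l => exec step (f l)) p w x y.
Proof.
elim: p w x y => [|l|p IHp q IHq|p IHp q IHq|p IHp] w x y //=.
- split=> -[w1 [w2 [z [-> pz qz]]]]; exists w1, w2, z; split=> //;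
    by [apply/IHp | apply/IHq].
- by split=> -[/IHp|/IHq]; [left | right | left | right].
- by split; apply: star_sub => ? ? ? /IHp.
Qed.

(** A step from an encoded state ends in an encoded state, so by induction a run that starts in the
    image of [h] never leaves it. *)
Lemma exec_simulation (Lab X Y : Type) (step : Lab -> seq S -> X -> X -> Prop)
    (step' : Lab -> seq S -> Y -> Y -> Prop) (h : X -> Y) :
  (forall l w x y, step' l w (h x) y <-> exists2 x', y = h x' & step l w x x') ->
  forall p w x y, exec step' p w (h x) y <->
    exists2 x', y = h x' & exec step p w x x'.
Proof.
move=> hs; elim=> [|l|p IHp q IHq|p IHp q IHq|p IHp] w x y /=.
- by split=> [[-> <-]|[x' -> [-> ->]]]; [exists x | ].
- exact: hs.
- split=> [[w1 [w2 [z [-> /IHp[z' ->] pz /IHq[y' -> qz]]]]]|].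
    by exists y' => //; exists w1, w2, z'.
  move=> [x' -> [w1 [w2 [z [-> pz qz]]]]]; exists w1, w2, (h z).
  by split=> //; [apply/IHp; exists z | apply/IHq; exists x'].
- split=> [[/IHp[x' -> px]|/IHq[x' -> qx]]|[x' -> [px|qx]]].
  + by exists x' => //; left.
  + by exists x' => //; right.
  + by left; apply/IHp; exists x'.
  + by right; apply/IHq; exists x'.
- split=> [|[x' ->]].
    move: {-2}(h x) (erefl (h x)) => z zE st; elim: st x zE => {w y z}.
      by move=> z x ->; exists x => //; apply: star_nil.
    move=> w1 w2 a b c ab _ IH x aE; move: ab; rewrite aE => /IHp[x1 bE px].
    by have [x2 -> sx] := IH _ bE; exists x2 => //; apply: star_cons px sx.
  elim=> [z|w1 w2 a b c ab _]; first exact: star_nil.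
  by apply: star_cons; apply/IHp; exists b.
Qed.

End ExecTheory.

Section FreeMonoid.
Local Open Scope ring_scope.

(* The columns of the block [o] of SL2 x SL2 inside SL4. *)
Definition ix (o b : bool) : 'I_4 := inord (o.*2 + b).

Lemma ix_eq o b o' b' : (ix o b == ix o' b') = (o == o') && (b == b').
Proof. by rewrite -val_eqE /= !inordK; case: o b o' b' => [] [] [] []. Qed.

Definition transv (i j : 'I_4) (c : int) : 'M[int]_4 := 1%:M + c *: delta_mx i j.

Lemma det_transv i j c : i != j -> \det (transv i j c) = 1.
Proof.
have trig (k l : 'I_4) : (l < k)%N -> \det (transv k l c) = 1.
  move=> lk; rewrite det_trig.
    rewrite big1 // => r _; rewrite !mxE eqxx.
    have -> : (r == k) && (r == l) = false.
      by apply/negbTE/negP => /andP[/eqP rk /eqP rl]; move: lk; rewrite -rk -rl ltnn.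
    by rewrite mulr0 addr0.
  apply/is_trig_mxP => r s rs; rewrite !mxE.
  have -> : (r == s) = false by apply/negbTE; rewrite -val_eqE /=; lia.
  have -> : (r == k) && (s == l) = false.
    by apply/negbTE/negP => /andP[/eqP rk /eqP sl]; move: rs lk; rewrite rk sl; lia.
  by rewrite mulr0 addr0.
move=> ij; have [lt|lt|/val_inj e] := ltngtP i j; last by rewrite e eqxx in ij.
  rewrite -det_tr.
  have -> : (transv i j c)^T = transv j i c.
    by rewrite /transv linearD linearZ /= trmx_delta tr_scalar_mx.
  exact: trig.
exact: trig.
Qed.

Lemma transvK i j c : i != j -> transv i j c *m transv i j (- c) = 1%:M.
Proof.
move=> ij; rewrite /transv mulmxDl mul1mx mulmxDr mulmx1.
rewrite -scalemxAl -scalemxAr mul_delta_mx_0 1?eq_sym // !scaler0 addr0.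
by rewrite scaleNr addrNK.
Qed.

(** The unipotent matrix of SL(2,Z) with [c] above or below the diagonal, according to [b], placed
    in the block [o]. *)
Definition gen (o b : bool) (c : int) := transv (ix o b) (ix o (~~ b)) c.

Lemma det_gen o b c : \det (gen o b c) = 1.
Proof. by apply: det_transv; rewrite ix_eq eqxx; case: b. Qed.

Lemma genK o b c : gen o b c *m gen o b (- c) = 1%:M.
Proof. by apply: transvK; rewrite ix_eq eqxx; case: b. Qed.

Lemma genC o b c o' b' c' : o != o' ->
  gen o b c *m gen o' b' c' = gen o' b' c' *m gen o b c.
Proof.
move=> oo'; rewrite /gen /transv !(mulmxDl, mulmxDr, mul1mx, mulmx1).
rewrite -!scalemxAl -!scalemxAr !mul_delta_mx_0 ?ix_eq 1?(eq_sym o') ?(negPf oo') //.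
by rewrite !scaler0 !addr0 -!addrA [X in _ + X = _]addrC.
Qed.

Definition wordmx (o : bool) (u : seq bool) : 'M[int]_4 :=
  foldl (fun A b => A *m gen o b 1) 1%:M u.

Lemma wordmx_rcons o u b : wordmx o (rcons u b) = wordmx o u *m gen o b 1.
Proof. by rewrite /wordmx foldl_rcons. Qed.

Lemma wordmxC o o' u b c : o != o' ->
  wordmx o u *m gen o' b c = gen o' b c *m wordmx o u.
Proof.
move=> oo'; elim/last_ind: u => [|u x IH]; first by rewrite mul1mx mulmx1.
by rewrite wordmx_rcons -mulmxA genC // !mulmxA IH.
Qed.

(* The monoid generated by [[1,1],[0,1]] and [[1,0],[1,1]] acts freely on the
   orbit of (1,1): the larger coordinate tells the last generator applied. *)
Fixpoint orbit1 (r : seq bool) : bool -> nat :=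
  if r is b :: r then fun b' => (orbit1 r b' + (b' == ~~ b) * orbit1 r b)%N
  else fun=> 1%N.

Lemma orbit1_gt0 r b : (0 < orbit1 r b)%N.
Proof. by elim: r b => [|x r IH] b //=; rewrite addn_gt0 IH. Qed.

Lemma orbit1_inj r s : orbit1 r =1 orbit1 s -> r = s.
Proof.
elim: r s => [|x r IH] [|y s] //=.
- move=> /(_ (~~ y)); rewrite eqxx mul1n.
  by have := orbit1_gt0 s y; have := orbit1_gt0 s (~~ y); lia.
- move=> /(_ (~~ x)); rewrite eqxx mul1n.
  by have := orbit1_gt0 r x; have := orbit1_gt0 r (~~ x); lia.
have [<-{y}|xy] := eqVneq x y => H.
  rewrite (IH s) // => b; have := H x; have := H (~~ x).
  rewrite eqxx !mul1n; have -> : (x == ~~ x) = false by case: x {H}.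
  by rewrite !mul0n !addn0; have [->|bx] := eqVneq b x; [lia | have -> : b = ~~ x by case: x b bx {H} => [] []]; lia.
have yE : y = ~~ x by case: x y xy {H} => [] [].
have := H x; have := H (~~ x); rewrite yE negbK eqxx !mul1n.
have -> : (x == ~~ x) = false by case: x {H xy yE}.
have -> : (~~ x == x) = false by case: x {H xy yE}.
have := orbit1_gt0 r x; have := orbit1_gt0 r (~~ x).
have := orbit1_gt0 s x; have := orbit1_gt0 s (~~ x).
by rewrite !mul0n !addn0; lia.
Qed.

Lemma row_gen (r : 'rV[int]_4) o b o' b' :
  (r *m gen o b 1) 0 (ix o' b') =
  r 0 (ix o' b') + ((o' == o) && (b' == ~~ b))%:R * r 0 (ix o b).
Proof.
rewrite /gen /transv scale1r mulmxDr mulmx1 mxE; congr (_ + _).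
rewrite !mxE (bigD1 (ix o b)) //= big1 ?addr0.
  by rewrite mxE eqxx ix_eq mulrC.
by move=> k kb; rewrite mxE (negPf kb) mulr0.
Qed.

(** [rev] appears because the head of the argument of [orbit1] is the generator applied last. The
    hypothesis concerns the block [o] alone, so that the two factors of [pairmx] can be applied one
    after the other. *)
Lemma row_wordmx (r : 'rV[int]_4) o u o' b' :
  (forall b, r 0 (ix o b) = 1) ->
  (r *m wordmx o u) 0 (ix o' b') =
  if o' == o then (orbit1 (rev u) b')%:R else r 0 (ix o' b').
Proof.
move=> r1; elim/last_ind: u b' o' => [|u x IH] b' o'.
  by rewrite mulmx1; case: eqP => // ->; rewrite r1.
rewrite wordmx_rcons mulmxA row_gen !IH eqxx rev_rcons /=.
by case: eqP => //= _; rewrite ?mul0r ?addr0 // natrD natrM.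
Qed.

Definition pairmx (q : seq bool * seq bool) : 'M[int]_4 :=
  wordmx false q.1 *m wordmx true q.2.

Lemma pairmx_inj : injective pairmx.
Proof.
have entry q o b : (const_mx 1 *m pairmx q : 'rV_4) 0 (ix o b) =
    (orbit1 (rev (if o then q.2 else q.1)) b)%:R.
  rewrite /pairmx mulmxA row_wordmx => [|b'].
    case: o => //=; rewrite row_wordmx // => b'; first by rewrite mxE.
  by rewrite row_wordmx => [|b'']; rewrite /= mxE.
move=> [u v] [u' v'] E.
have H o : rev (if o then v else u) = rev (if o then v' else u').
  apply: orbit1_inj => b; have := entry (u, v) o b; rewrite E entry /= => /eqP.
  by rewrite eqr_nat => /eqP.
by move: (H true) (H false) => /= /(can_inj revK)-> /(can_inj revK)->.
Qed.
End FreeMonoid.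

(** * Queue programs run in the matrix register *)

Section Queue.
Local Open Scope ring_scope.
Variable S : finType.

(* [inr (true, b)] appends [b] to the word of dequeued letters and
   [inr (false, b)] to the word of enqueued ones. *)
Definition qlabel : eqType := (S + bool * bool)%type.

Definition qstep (l : qlabel) (w : seq S) (x y : seq bool * seq bool) : Prop :=
  match l with
  | inl a => w = [:: a] /\ y = x
  | inr (true, b) => w = [::] /\ y = (rcons x.1 b, x.2)
  | inr (false, b) => w = [::] /\ y = (x.1, rcons x.2 b)
  end.

Definition mlabel : eqType := (qlabel + bool)%type.

Definition mword (l : mlabel) : option S := if l is inl (inl a) then Some a else None.

(** The label [inr b] strips a last letter [b] from both words at once; repeated stripping leads to
    the identity exactly from pairs of equal words. *)
Definition mmat (l : mlabel) : 'M[int]_4 :=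
  match l with
  | inl (inl _) => 1%:M
  | inl (inr (d, b)) => gen (~~ d) b 1
  | inr b => gen false b (- 1) *m gen true b (- 1)
  end.

Lemma det_mmat l : \det (mmat l) = 1.
Proof. by case: l => [[a|[d b]]|b] /=; rewrite ?det_mulmx ?det_gen ?det1 ?mulr1. Qed.

Definition toC (A : 'M[int]_4) : Mat := map_mx (fun z : int => z%:~R) A.

Lemma toC1 : toC 1%:M = 1%:M.
Proof. by rewrite /toC (map_mx1 (intmul 1 : {rmorphism int -> C})). Qed.

Lemma toCM A B : toC (A *m B) = toC A *m toC B.
Proof. by rewrite /toC (map_mxM (intmul 1 : {rmorphism int -> C})). Qed.

Lemma toC_inj : injective toC.
Proof.
move=> A B /matrixP E; apply/matrixP => i j; have := E i j.
by rewrite !mxE => /intr_inj.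
Qed.

Lemma pairmx_deq u v b : pairmx (rcons u b, v) = pairmx (u, v) *m gen false b 1.
Proof. by rewrite /pairmx /= wordmx_rcons -!mulmxA wordmxC. Qed.

Lemma pairmx_enq u v b : pairmx (u, rcons v b) = pairmx (u, v) *m gen true b 1.
Proof. by rewrite /pairmx /= wordmx_rcons !mulmxA. Qed.

Lemma pop_gen b : gen false b (- 1) *m gen true b (- 1) *m (gen false b 1 *m gen true b 1) = 1%:M.
Proof.
rewrite mulmxA -(mulmxA (gen false b (-1))) genC // !mulmxA.
by rewrite -{2}[1]opprK genK mul1mx -{2}[1]opprK genK.
Qed.

Lemma gen_pop b : gen false b 1 *m gen true b 1 *m (gen false b (- 1) *m gen true b (- 1)) = 1%:M.
Proof. by rewrite mulmxA -(mulmxA (gen false b 1)) genC // !mulmxA genK mul1mx genK. Qed.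

Let step := @mstep S mlabel mword (fun l => toC (mmat l)).

Lemma exec_qstep (p : rexp qlabel) w q y :
  exec step (bind (fun l => Atom (inl l : mlabel)) p) w (toC (pairmx q)) y <->
  exists2 q', y = toC (pairmx q') & exec qstep p w q q'.
Proof.
rewrite exec_bind; apply: (exec_simulation (h := fun q => toC (pairmx q))).
move=> [a|[d b]] v [r s] z; rewrite /= /step /mstep /=.
  rewrite toC1 mulmx1; split=> [[-> ->]|[q' -> [-> ->]]//].
  by exists (r, s).
rewrite -toCM; case: d => /=; rewrite -?pairmx_deq -?pairmx_enq;
  by split=> [[-> ->]|[q' -> [-> ->]]//]; eexists.
Qed.

Definition popper : rexp mlabel :=
  Star (Alt (Atom (inr true : mlabel)) (Atom (inr false : mlabel))).

Lemma pairmx11 : pairmx ([::], [::]) = 1%:M.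
Proof. by rewrite /pairmx mul1mx. Qed.

(** Followed backwards from the identity, each pop appends one letter to both words. So an arbitrary
    matrix that pops reduce to the identity encodes a pair of equal words. *)
Lemma exec_popper w x :
  exec step popper w x 1%:M <-> w = [::] /\ exists u, x = toC (pairmx (u, u)).
Proof.
have popE v z y : exec step (Alt (Atom (inr true : mlabel)) (Atom (inr false : mlabel))) v z y <->
    exists b, v = [::] /\ y = z *m toC (mmat (inr b)).
  split=> [[[-> ->]|[-> ->]]|[[] [-> ->]]]; first by exists true.
  - by exists false.
  - by left.
  - by right.
split=> [|[-> [u ->]]].
  rewrite /popper /=; move: {1 3}1%:M (erefl (1%:M : Mat)) => y yE st.
  elim: st yE => {w x y} [x ->|w1 w2 x y z /popE[b [-> yE]] _ IH /IH[-> [u uE]]].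
    by split=> //; exists [::]; rewrite pairmx11 toC1.
  split=> //; exists (rcons u b); rewrite pairmx_enq pairmx_deq toCM toCM -uE yE.
  by rewrite -!mulmxA -!toCM /= pop_gen toC1 mulmx1.
elim/last_ind: u => [|u b IH]; first by rewrite pairmx11 toC1; apply: star_nil.
apply: (@star_cons _ _ _ [::] [::] _ (toC (pairmx (u, u)))) => //.
apply/popE; exists b; split=> //.
by rewrite pairmx_enq pairmx_deq -toCM -!mulmxA (mulmxA (gen false b 1)) gen_pop mulmx1.
Qed.

Lemma queue_in_LG (G : Mat -> Prop) (p : rexp qlabel) (L : seq S -> Prop) :
  matrix_group G -> contains_SL4Z G ->
  (forall w, L w <-> exists u, exec qstep p w ([::], [::]) (u, u)) -> in_LG G L.
Proof.
move=> [G1 _ _] GS LE.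
apply: (@rational_in_LG S G _ mword (fun l => toC (mmat l)) G1 _
  (Seq (bind (fun l => Atom (inl l : mlabel)) p) popper)) => [l|w].
  exact/GS/det_mmat.
rewrite LE; split=> [[u pu]|[w1 [w2 [z [-> pz /exec_popper[-> [u zE]]]]]]].
  exists w, [::], (toC (pairmx (u, u))); split; first by rewrite cats0.
    by rewrite -toC1 -pairmx11; apply/exec_qstep; exists (u, u).
  by apply/exec_popper; split=> //; exists u.
(* The pair reached by the program has the same matrix as [(u, u)], hence is [(u, u)] by
   freeness. *)
exists u; move: pz; rewrite zE -toC1 -pairmx11 => /exec_qstep[q' /toC_inj/pairmx_inj <-].
by rewrite cats0.
Qed.
End Queue.

(** * Register programs *)

Section Registers.
Variable S : finType.

Inductive instr : Type :=
| Inc of nat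
| Dec of nat
| Zero of nat
| Read of S.

Definition upd (s : nat -> nat) (i n : nat) : nat -> nat :=
  fun j => if j == i then n else s j.

Definition rstep (l : instr) (w : seq S) (s s' : nat -> nat) : Prop :=
  match l with
  | Inc i => w = [::] /\ s' = upd s i (s i).+1
  | Dec i => [/\ w = [::], s i != 0 & s' = upd s i (s i).-1]
  | Zero i => [/\ w = [::], s i = 0 & s' = s]
  | Read a => w = [:: a] /\ s' = s
  end.

Definition reg (l : instr) : nat :=
  match l with Inc i | Dec i | Zero i => i | Read _ => 0 end.

Fixpoint maxreg (p : rexp instr) : nat :=
  match p with
  | Eps => 0
  | Atom l => reg l
  | Seq p q | Alt p q => maxn (maxreg p) (maxreg q)
  | Star p => maxreg p
  end.

(** Each register is a unary block closed by [false], so that a sequence of blocks is parsed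
    uniquely whatever follows it. *)
Definition encs (js : seq nat) (s : nat -> nat) : seq bool :=
  flatten [seq rcons (nseq (s j) true) false | j <- js].

Lemma eq_encs js s s' : {in js, s =1 s'} -> encs js s = encs js s'.
Proof. by move=> ss'; congr flatten; apply/eq_in_map => j /ss' ->. Qed.

Lemma unary_inj m n a b :
  rcons (nseq m true) false ++ a = rcons (nseq n true) false ++ b -> m = n /\ a = b.
Proof.
elim: m n => [|m IH] [|n] //=; first by case.
by case=> /IH[-> ->].
Qed.

Lemma encs_inj js s s' a b :
  encs js s ++ a = encs js s' ++ b -> {in js, s =1 s'} /\ a = b.
Proof.
elim: js => [|j js IH] /=; first by [].
rewrite /encs /= -!catA => /unary_inj[sj /IH[ss' ->]]; split=> // k.
by rewrite inE => /orP[/eqP->|/ss'].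
Qed.

Let deq b : rexp (qlabel S) := Atom (inr (true, b) : qlabel S).
Let enq b : rexp (qlabel S) := Atom (inr (false, b) : qlabel S).
Let copy : rexp (qlabel S) := Star (Seq (deq true) (enq true)).

(** Passes the block of register [j] through the queue, from front to back, applying [l] on the way.
    The length of the block is guessed by [copy]. *)
Definition field (l : instr) (j : nat) : rexp (qlabel S) :=
  Seq (match l with
       | Inc i => if j == i then Seq copy (enq true) else copy
       | Dec i => if j == i then Seq copy (deq true) else copy
       | Zero i => if j == i then Eps else copy
       | Read _ => copy
       end) (Seq (deq false) (enq false)).

Definition field_rel (l : instr) (j m n : nat) : Prop :=
  match l with
  | Inc i => if j == i then n = m.+1 else n = m
  | Dec i => if j == i then m = n.+1 else n = m
  | Zero i => if j == i then m = 0 /\ n = 0 else n = m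
  | Read _ => n = m
  end.

(** One instruction rotates the queue once around: a block is reached only by moving those in front
    of it to the back. *)
Definition translate (K : nat) (l : instr) : rexp (qlabel S) :=
  if l is Read a then Atom (inl a : qlabel S)
  else foldr (fun j => Seq (field l j)) Eps (iota 0 K).

Let qexec := exec (@qstep S).

Lemma exec_copy w x y : qexec copy w x y <->
  w = [::] /\ exists n, y = (x.1 ++ nseq n true, x.2 ++ nseq n true).
Proof.
split=> [|[-> [n ->]]].
  elim=> {w x y} [[u v]|w1 w2 x y z]; first by split=> //; exists 0; rewrite !cats0.
  move=> [w3 [w4 [t [-> /= [-> ->] [-> ->]]]]] _ [-> [n ->]]; split=> //.
  by exists n.+1; rewrite /= !cat_rcons.
elim: n x => [|n IH] [u v] /=; first by rewrite !cats0; apply: star_nil.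
apply: (@star_cons _ _ _ [::] [::] _ (rcons u true, rcons v true)).
  by exists [::], [::], (rcons u true, v).
by have := IH (rcons u true, rcons v true); rewrite /= !cat_rcons.
Qed.

Lemma exec_field l j w x y : qexec (field l j) w x y <->
  w = [::] /\ exists m n, [/\ field_rel l j m n,
    y.1 = x.1 ++ rcons (nseq m true) false & y.2 = x.2 ++ rcons (nseq n true) false].
Proof.
have nseq1 n : rcons (nseq n true) true = true :: nseq n true.
  by elim: n => //= n ->.
have closeE v z : qexec (Seq (deq false) (enq false)) v z y <->
    v = [::] /\ y = (rcons z.1 false, rcons z.2 false).
  split=> [[w1 [w2 [t [-> [-> ->] [-> ->]]]]] //|[-> ->]].
  by exists [::], [::], (rcons z.1 false, z.2).
suff bodyE (b : rexp (qlabel S)) : (forall v z, qexec b v x z <->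
    v = [::] /\ exists m n, field_rel l j m n /\
    z = (x.1 ++ nseq m true, x.2 ++ nseq n true)) ->
    qexec (Seq b (Seq (deq false) (enq false))) w x y <->
    w = [::] /\ exists m n, [/\ field_rel l j m n,
    y.1 = x.1 ++ rcons (nseq m true) false & y.2 = x.2 ++ rcons (nseq n true) false].
  have cE v z : qexec copy v x z <-> v = [::] /\ exists m n, n = m /\
      z = (x.1 ++ nseq m true, x.2 ++ nseq n true).
    rewrite exec_copy; split=> [[-> [n ->]]|[-> [m [n [-> ->]]]]].
      by split=> //; exists n, n.
    by split=> //; exists m.
  apply: bodyE => v z; case: l => [i|i|i|a]; last exact: cE;
    rewrite /field_rel; case: ifP => _; try exact: cE.
  - split=> [[w1 [w2 [t [-> /exec_copy[-> [n ->]] [-> ->]]]]]|[-> [m [n [-> ->]]]]].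
      split=> //; exists n, n.+1; split=> //=.
      by rewrite rcons_cat nseq1.
    exists [::], [::], (x.1 ++ nseq m true, x.2 ++ nseq m true); split=> //.
      by apply/exec_copy; split=> //; exists m.
    by split=> //=; rewrite rcons_cat nseq1.
  - split=> [[w1 [w2 [t [-> /exec_copy[-> [n ->]] [-> ->]]]]]|[-> [m [n [-> ->]]]]].
      split=> //; exists n.+1, n; split=> //=.
      by rewrite rcons_cat nseq1.
    exists [::], [::], (x.1 ++ nseq n true, x.2 ++ nseq n true); split=> //.
      by apply/exec_copy; split=> //; exists n.
    by split=> //=; rewrite rcons_cat nseq1.
  - split=> [[-> <-]|[-> [m [n [[-> ->] ->]]]]]; last by rewrite !cats0; case: x {cE}.
    by split=> //; exists 0, 0; rewrite !cats0; case: x {cE}.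
move=> bE; split=> [[w1 [w2 [z [-> /bE[-> [m [n [mn ->]]]] /closeE[-> ->]]]]]|].
  by split=> //; exists m, n; split=> //=; rewrite rcons_cat.
move=> [-> [m [n [mn y1 y2]]]].
exists [::], [::], (x.1 ++ nseq m true, x.2 ++ nseq n true); split=> //.
  by apply/bE; split=> //; exists m, n.
apply/closeE; split=> //; rewrite !rcons_cat -y1 -y2.
by case: y {closeE y1 y2 bE}.
Qed.

(** Here [s] is only what the run claims to find in the queue; it is tied to the true contents in
    [bind_sound]. *)
Lemma exec_fields l js w x y : uniq js ->
  qexec (foldr (fun j => Seq (field l j)) Eps js) w x y <->
  w = [::] /\ exists s s', [/\ {in js, forall j, field_rel l j (s j) (s' j)},
    y.1 = x.1 ++ encs js s & y.2 = x.2 ++ encs js s'].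
Proof.
elim: js w x => [|j js IH] w x /=.
  move=> _; split=> [[-> <-]|[-> [s [s' [_ y1 y2]]]]].
    by split=> //; exists id, id; rewrite !cats0.
  by rewrite !cats0 in y1 y2; split=> //; case: x y y1 y2 => [? ?] [? ?] /= -> ->.
move=> /andP[jjs ujs].
split=> [[w1 [w2 [z [-> /exec_field[-> [m [n [mn z1 z2]]]] zy]]]]|].
  move: zy => /(IH _ _ ujs)[-> [s [s' [ss' y1 y2]]]]; split=> //.
  have jk k t d : k \in js -> upd t j d k = t k.
    by rewrite /upd => kjs; case: eqP => // kj; rewrite -kj kjs in jjs.
  have updE t d : encs (j :: js) (upd t j d) = rcons (nseq d true) false ++ encs js t.
    rewrite /encs /= /upd eqxx; congr (_ ++ _).
    by apply: eq_encs => k kjs; apply: jk.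
  exists (upd s j m), (upd s' j n); split; rewrite ?updE ?y1 ?y2 ?z1 ?z2 ?catA //.
  move=> k; rewrite inE; case: eqP => /= [-> _|_ kjs].
    by rewrite /upd eqxx.
  by rewrite !jk //; apply: ss'.
move=> [-> [s [s' [ss' y1 y2]]]].
exists [::], [::], (x.1 ++ rcons (nseq (s j) true) false, x.2 ++ rcons (nseq (s' j) true) false).
split=> //.
  by apply/exec_field; split=> //; exists (s j), (s' j); split=> //; apply: ss'; rewrite mem_head.
apply/(IH _ _ ujs); split=> //; exists s, s'; split; rewrite /= -?catA // => k kjs.
by apply: ss'; rewrite inE kjs orbT.
Qed.

Definition silent (l : instr) : bool := if l is Read _ then false else true.

Lemma field_rel_step l K s t : silent l -> reg l < K ->
  {in iota 0 K, forall j, field_rel l j (s j) (t j)} ->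
  exists2 s', rstep l [::] s s' & {in iota 0 K, t =1 s'}.
Proof.
move=> lr lK H.
have iK : reg l \in iota 0 K by rewrite mem_iota add0n.
case: l lr H iK {lK} => [i|i|i|a] //= _ H iK.
- exists (upd s i (s i).+1) => // j /H.
  by rewrite /upd; case: eqP => [->|].
- have si := H _ iK; rewrite eqxx in si.
  exists (upd s i (s i).-1); first by rewrite si.
  by move=> j /H; rewrite /upd; case: eqP => [-> ->|].
- have := H _ iK; rewrite eqxx => -[si ti].
  by exists s => // j /H; case: eqP => [-> _|//]; rewrite si ti.
Qed.

Lemma step_field_rel l K w s s' : silent l -> rstep l w s s' ->
  w = [::] /\ {in iota 0 K, forall j, field_rel l j (s j) (s' j)}.
Proof.
case: l => [i|i|i|a] //= _.
- by move=> [-> ->]; split=> // j _; rewrite /upd; case: eqP => [->|].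
- move=> [-> si ->]; split=> // j _; rewrite /upd; case: eqP => [->|//].
  by rewrite prednK // lt0n.
- by move=> [-> si ->]; split=> // j _; case: eqP => [->|].
Qed.

Lemma translate_silent K l : silent l ->
  translate K l = foldr (fun j => Seq (field l j)) Eps (iota 0 K).
Proof. by case: l. Qed.

(** Carries the completion hypothesis of [bind_sound] from the end of a run back to its intermediate
    points. *)
Lemma qexec_mono p w x y : qexec p w x y ->
  exists a b, y.1 = x.1 ++ a /\ y.2 = x.2 ++ b.
Proof.
elim: p w x y => [|l|p IHp q IHq|p IHp q IHq|p IHp] w x y /=.
- by move=> [_ <-]; exists [::], [::]; rewrite !cats0.
- case: l => [a [_ ->]|[[] b] [_ ->]] /=; [exists [::], [::] | exists [:: b], [::] | exists [::], [:: b]];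
    by rewrite ?cats1 ?cats0.
- move=> [_ [_ [z [_ /IHp[a [b [z1 z2]]] /IHq[c [d [y1 y2]]]]]]].
  by exists (a ++ c), (b ++ d); rewrite y1 y2 z1 z2 !catA.
- by case=> [/IHp|/IHq].
- elim=> [z|_ _ z t u /IHp[a [b [z1 z2]]] _ [c [d [y1 y2]]]].
    by exists [::], [::]; rewrite !cats0.
  by exists (a ++ c), (b ++ d); rewrite y1 y2 z1 z2 !catA.
Qed.

(* [c] and [d] complete both words to the same one, as they must at the end of
   an accepting run; this forces each dequeued block to be the current state. *)
Lemma bind_sound K p w x y s c d : maxreg p < K ->
  qexec (bind (translate K) p) w x y ->
  x.2 = x.1 ++ encs (iota 0 K) s -> y.1 ++ c = y.2 ++ d ->
  exists2 s', exec rstep p w s s' & y.2 = y.1 ++ encs (iota 0 K) s'.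
Proof.
elim: p w x y s c d => [|l|p IHp q IHq|p IHp q IHq|p IHp] w x y s c d /= pK.
- by move=> [-> <-] xE _; exists s.
- case: (boolP (silent l)) => [sl|].
    rewrite translate_silent // => /(exec_fields _ _ _ _ (iota_uniq _ _)).
    move=> [-> [t [t' [tt' y1 y2]]]] xE; rewrite y1 y2 xE -!catA.
    (* Past the common prefix [x.1], one side starts with the guessed blocks and the other with the
       true ones, and unique parsing identifies them. *)
    move=> /(congr1 (drop (size x.1))); rewrite !drop_size_cat //.
    move=> /encs_inj[ts _].
    have [|s' ss' t's'] := @field_rel_step l K s t' sl pK.
      by move=> j jK; rewrite -ts //; apply: tt'.
    by exists s' => //; rewrite (eq_encs ts) (eq_encs t's') ?catA.
  by case: l pK => // a _ _ [-> ->] xE _; exists s.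
- rewrite gtn_max in pK; case/andP: pK => pK qK.
  move=> [w1 [w2 [z [-> pz qz]]]] xE yE.
  have [a [b [y1 y2]]] := qexec_mono qz.
  have [|s1 ps zE] := IHp _ _ _ _ (a ++ c) (b ++ d) pK pz xE.
    by rewrite !catA -y1 -y2.
  have [s2 qs y2E] := IHq _ _ _ _ _ _ qK qz zE yE.
  by exists s2 => //; exists w1, w2, s1.
- rewrite gtn_max in pK; case/andP: pK => pK qK [pz|qz] xE yE.
    by have [s' ps y2] := IHp _ _ _ _ _ _ pK pz xE yE; exists s' => //; left.
  by have [s' ps y2] := IHq _ _ _ _ _ _ qK qz xE yE; exists s' => //; right.
- move=> st; elim: st s => {w x y} [x|w1 w2 x y z pxy st IH] s xE yE.
    by exists s => //; apply: star_nil.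
  have [a [b [z1 z2]]] : exists a b, z.1 = y.1 ++ a /\ z.2 = y.2 ++ b.
    exact: (@qexec_mono (Star (bind (translate K) p)) _ _ _ st).
  have [|s1 ps zE] := IHp _ _ _ _ (a ++ c) (b ++ d) pK pxy xE.
    by rewrite !catA -z1 -z2.
  have [s2 qs y2E] := IH _ zE yE.
  by exists s2 => //; apply: star_cons qs.
Qed.

Lemma bind_complete K p w s s' u : maxreg p < K -> exec rstep p w s s' ->
  exists u', qexec (bind (translate K) p) w
    (u, u ++ encs (iota 0 K) s) (u', u' ++ encs (iota 0 K) s').
Proof.
elim: p w s s' u => [|l|p IHp q IHq|p IHp q IHq|p IHp] w s s' u /= pK.
- by move=> [-> <-]; exists u.
- case: (boolP (silent l)) => [sl|].
    move=> /(step_field_rel K sl)[-> ss']; rewrite translate_silent //.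
    exists (u ++ encs (iota 0 K) s); apply/exec_fields; first exact: iota_uniq.
    by split=> //; exists s, s'.
  by case: l pK => // a _ _ [-> ->]; exists u.
- rewrite gtn_max in pK; case/andP: pK => pK qK.
  move=> [w1 [w2 [s1 [-> /(IHp _ _ _ u pK)[u1 p1] /(IHq _ _ _ u1 qK)[u2 q2]]]]].
  by exists u2, w1, w2, (u1, u1 ++ encs (iota 0 K) s1).
- rewrite gtn_max in pK; case/andP: pK => pK qK.
  case=> [/(IHp _ _ _ u pK)|/(IHq _ _ _ u qK)] [u1 p1]; exists u1; by [left|right].
- move=> st; elim: st u => {w s s'} [s|w1 w2 s s1 s2 /IHp pxy st IH] u.
    by exists u; apply: star_nil.
  have [u1 p1] := pxy u pK; have [u2 p2] := IH u1.
  by exists u2; apply: star_cons p1 p2.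
Qed.

Definition puts (d : bool) (n : nat) : rexp (qlabel S) :=
  iter n (Seq (if d then deq false else enq false)) Eps.

Lemma exec_puts d n w x y : qexec (puts d n) w x y <->
  w = [::] /\ y = if d then (x.1 ++ nseq n false, x.2) else (x.1, x.2 ++ nseq n false).
Proof.
elim: n w x y => [|n IH] w x y /=.
  by rewrite !cats0; split=> [[-> <-]|[-> ->]]; case: d; case: x.
rewrite -/(puts d n); split=> [[w1 [w2 [z [-> dz /IH[-> ->]]]]]|[-> ->]].
  by case: d dz {IH} => /= -[-> ->]; rewrite cat_rcons.
exists [::], [::], (if d then (rcons x.1 false, x.2) else (x.1, rcons x.2 false)).
split=> //; first by case: d {IH}.
by apply/IH; split=> //; case: d {IH}; rewrite /= cat_rcons.
Qed.

Lemma encs0 js : encs js (fun=> 0) = nseq (size js) false.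
Proof. by elim: js => //= j js; rewrite /encs /= => ->. Qed.

(** [K] empty blocks are put in at the start and taken out at the end, so for completeness an
    accepting run must leave all registers at 0; soundness holds for any final registers. *)
Lemma register_in_LG (G : Mat -> Prop) (p : rexp instr) (L : seq S -> Prop) :
  matrix_group G -> contains_SL4Z G ->
  (forall w s, exec rstep p w (fun=> 0) s -> L w) ->
  (forall w, L w -> exec rstep p w (fun=> 0) (fun=> 0)) -> in_LG G L.
Proof.
move=> gG GS pL Lp; have [K pK] : exists K, maxreg p < K by exists (maxreg p).+1.
pose b0 := nseq K false.
apply: (@queue_in_LG S G (Seq (puts false K) (Seq (bind (translate K) p) (puts true K))) L gG GS).
have b0E : b0 = encs (iota 0 K) (fun=> 0) by rewrite encs0 size_iota.
move=> w; split=> [/Lp/(bind_complete [::] pK)[u pu]|].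
  exists (u ++ b0), [::], w, ([::], b0); split=> //; first exact/exec_puts.
  exists w, [::], (u, u ++ b0); rewrite cats0; split=> //; last exact/exec_puts.
  by rewrite b0E.
move=> [u [w1 [w2 [x [-> /exec_puts[-> ->] [w3 [w4 [y [-> py /exec_puts[-> [uE yE]]]]]]]]]]].
rewrite /= cats0.
(* The letters [b0] taken out at the end complete the first word; the second is already complete. *)
have [||s ps _] := @bind_sound K p w3 _ y (fun=> 0) b0 [::] pK py.
- by rewrite /= -b0E.
- by rewrite cats0 -yE.
exact: pL ps.
Qed.
End Registers.

(** * Compilation of recursive functions *)

Section PrfTheory.

(** The generated principle gives no hypothesis on the list inside [PComp]. *)
Lemma prf_nested_ind (P : prf -> Prop) :
  P PZero -> P PSucc -> (forall i, P (PProj i)) ->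
  (forall f gs, P f -> (forall g, List.In g gs -> P g) -> P (PComp f gs)) ->
  (forall f g, P f -> P g -> P (PPrec f g)) ->
  (forall f, P f -> P (PMu f)) -> forall f, P f.
Proof.
move=> Pz Ps Pp Pc Pr Pm; fix IH 1 => -[||i|f gs|f g|f].
- exact: Pz.
- exact: Ps.
- exact: Pp.
- apply: Pc; first exact: IH.
  elim: gs => [|h gs IHgs] g; first by case.
  by case=> [<-|ggs]; [apply: IH | apply: IHgs].
- by apply: Pr; apply: IH.
- by apply: Pm; apply: IH.
Qed.

Lemma nth_List (T : Type) (x : T) s i : List.nth i s x = nth x s i.
Proof. by elim: s i => [|y s IH] [|i] //=. Qed.

Lemma prf_zeroE v y : prf_eval PZero v y <-> y = 0.
Proof. by split=> [H|->]; [inversion H | apply: ev_zero]. Qed.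

Lemma prf_succE v y : prf_eval PSucc v y <-> y = (nth 0 v 0).+1.
Proof.
rewrite -nth_List; split=> [H|->]; first by inversion H; clear; case: v.
by have := ev_succ v; case: v.
Qed.

Lemma prf_projE i v y : prf_eval (PProj i) v y <-> y = nth 0 v i.
Proof.
rewrite -nth_List; split=> [H|->]; first by inversion H.
exact: ev_proj.
Qed.

Lemma prf_compE f gs v y : prf_eval (PComp f gs) v y <->
  exists ys, prf_evals gs v ys /\ prf_eval f ys y.
Proof.
split=> [H|[ys [gy fy]]]; last exact: ev_comp gy fy.
by inversion H; exists ys.
Qed.

Lemma prf_evals_nil v ys : prf_evals [::] v ys <-> ys = [::].
Proof. by split=> [H|->]; [inversion H | apply: evs_nil]. Qed.

Lemma prf_evals_cons g gs v ys : prf_evals (g :: gs) v ys <->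
  exists y zs, [/\ ys = y :: zs, prf_eval g v y & prf_evals gs v zs].
Proof.
split=> [H|[y [zs [-> gy gz]]]]; last exact: evs_cons.
by inversion H; exists y, ys0.
Qed.

Lemma prf_prec_nil f g y : ~ prf_eval (PPrec f g) [::] y.
Proof. by move=> H; inversion H. Qed.

Lemma prf_prec0 f g v y : prf_eval (PPrec f g) (0 :: v) y <-> prf_eval f v y.
Proof. by split=> [H|]; [inversion H | apply: ev_prec0]. Qed.

Lemma prf_precS f g n v y : prf_eval (PPrec f g) (n.+1 :: v) y <->
  exists r, prf_eval (PPrec f g) (n :: v) r /\ prf_eval g [:: n, r & v] y.
Proof.
split=> [H|[r [fr gy]]]; last exact: ev_precS fr gy.
by inversion H; exists r.
Qed.

Lemma prf_muE f v y : prf_eval (PMu f) v y <->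
  prf_eval f (y :: v) 0 /\ forall z, z < y -> exists r, prf_eval f (z :: v) r.+1.
Proof.
split=> [H|[f0 fr]]; last exact: ev_mu.
by inversion H.
Qed.
End PrfTheory.

Section Compilation.
Variable S : finType.
Let prog := rexp (instr S).
Let run : prog -> seq S -> (nat -> nat) -> (nat -> nat) -> Prop := exec (@rstep S).
Let inc r : prog := Atom (Inc S r).
Let dec r : prog := Atom (Dec S r).
Let zero r : prog := Atom (Zero S r).

Fixpoint itr (n : nat) (X : Type) (R : X -> X -> Prop) (x y : X) : Prop :=
  if n is n.+1 then exists2 z, R x z & itr n R z y else y = x.

Lemma itrSr n X (R : X -> X -> Prop) x y z :
  itr n R x y -> R y z -> itr n.+1 R x z.
Proof.
elim: n x => [|n IH] x /=; first by move=> -> yz; exists z.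
by move=> [t xt ty] yz; exists t => //; apply: IH.
Qed.

Lemma itr_fun n X (R : X -> X -> Prop) (h : X -> X) x y :
  (forall x y, R x y <-> y = h x) -> itr n R x y <-> y = iter n h x.
Proof.
move=> Rh; elim: n x => [|n IH] x //; rewrite iterSr -IH /=.
by split=> [[z /Rh->]|xy] //; exists (h x) => //; apply/Rh.
Qed.

Definition loop (r : nat) (body : prog) : prog := Seq (Star (Seq (dec r) body)) (zero r).

(** The star may be left at any time, but each pass lowers [r] by exactly one and [zero r] must
    succeed at the end, which forces [s r] passes. *)
Lemma loopP (I : (nat -> nat) -> Prop) r body :
  (forall s w s', I s -> s r != 0 -> run body w (upd s r (s r).-1) s' ->
    [/\ w = [::], s' r = (s r).-1 & I s']) ->
  forall s w s', I s -> run (loop r body) w s s' <-> w = [::] /\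
    itr (s r) (fun s s' => run body [::] (upd s r (s r).-1) s') s s'.
Proof.
move=> bI s w s' Is; split.
  move=> [w1 [w2 [z [-> st [-> zr ->]]]]]; rewrite cats0.
  elim: st zr Is => {w1 z} [z -> //|w1 w3 x y z].
  move=> [w4 [w5 [t [-> [-> xr ->] bt]]]] _ IH zr Ix.
  have [w50 yr Iy] := bI _ _ _ Ix xr bt; rewrite w50 in bt *; have [-> yz] := IH zr Iy.
  split=> //; case xrE: (x r) xr => [//|n] _.
  by exists y; [exact: bt | move: yz; rewrite yr xrE].
move=> [-> it]; suff [z st zr] : exists2 z, run (Star (Seq (dec r) body)) [::] s z & z r = 0 /\ s' = z.
  by exists [::], [::], z; split=> //; split=> //; case: zr.
move: {-2}(s r) (erefl (s r)) it => n; elim: n s Is => [|n IH] s Is sr /=.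
  by move=> ->; exists s => //; apply: star_nil.
move=> [t bt it]; have srn : s r != 0 by rewrite -sr.
have [_ tr It] := bI _ _ _ Is srn bt.
have [||z st zr] := IH t It; rewrite ?tr -?sr //.
exists z => //; apply: (@star_cons _ _ _ [::] [::] _ t) => //.
by exists [::], [::], (upd s r (s r).-1).
Qed.

Definition fn (p : prog) (h : (nat -> nat) -> nat -> nat) : Prop :=
  forall w s s', run p w s s' <-> w = [::] /\ s' = h s.

Lemma fn_ext p h h' : fn p h -> (forall s, h s =1 h' s) -> fn p h'.
Proof.
move=> ph hh w s s'; rewrite ph; have -> // : h s = h' s.
by apply: functional_extensionality => j; apply: hh.
Qed.

Lemma fn_inc r : fn (inc r) (fun s => upd s r (s r).+1).
Proof. by []. Qed.

Lemma fn_seq p q h k : fn p h -> fn q k -> fn (Seq p q) (fun s => k (h s)).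
Proof.
move=> ph qk w s s'; split=> [[w1 [w2 [z [-> /ph[-> ->] /qk[-> ->]]]]]//|[-> ->]].
by exists [::], [::], (h s); split=> //; [apply/ph | apply/qk].
Qed.

Lemma run_seq p h q w s s' : fn p h -> run (Seq p q) w s s' <-> run q w (h s) s'.
Proof.
move=> ph; split=> [[w1 [w2 [z [-> /ph[-> ->] //]]]]|qs].
by exists [::], w, (h s); split=> //; apply/ph.
Qed.

Lemma fn_loop r body h : fn body h -> (forall s, h s r = s r) ->
  fn (loop r body) (fun s => iter (s r) (fun s => h (upd s r (s r).-1)) s).
Proof.
move=> bh hr w s s'; rewrite (@loopP (fun=> True)) => // [|s1 w1 s2 _ _ /bh[-> ->]].
  rewrite (@itr_fun _ _ _ (fun s => h (upd s r (s r).-1))) // => t t'.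
  by rewrite bh; split=> [[]|].
by split=> //; rewrite hr /upd eqxx.
Qed.

Definition clear r : prog := loop r Eps.

Lemma fn_clear r : fn (clear r) (fun s => upd s r 0).
Proof.
have e : fn Eps id by move=> w s s'; split=> [[-> ->]|[-> ->]].
apply: fn_ext (fn_loop e (fun=> erefl)) _ => s j.
move: {-2}(s r) (erefl (s r)) => n; elim: n s => [|n IH] s sr.
  by rewrite /= /upd; case: eqP => // ->.
by rewrite iterSr IH /upd ?eqxx -?sr //; case: eqP.
Qed.

(** A loop consumes its counter, so [a] is emptied into [o] and [t] together and then restored from
    [t]. *)
Definition copy (a o t : nat) : prog :=
  Seq (Seq (clear o) (clear t)) (Seq (loop a (Seq (inc o) (inc t))) (loop t (inc a))).

Lemma fn_copy a o t : a != o -> a != t -> o != t ->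
  fn (copy a o t) (fun s => upd (upd s o (s a)) t 0).
Proof.
move=> ao a_t ot; have [oa ta to] : [/\ o != a, t != a & t != o].
  by split; rewrite eq_sym.
apply: (fn_ext (fn_seq (fn_seq (fn_clear o) (fn_clear t))
  (fn_seq (fn_loop (fn_seq (fn_inc o) (fn_inc t)) _) (fn_loop (fn_inc a) _)))).
- by move=> s; rewrite /upd (negPf a_t) (negPf ao).
- by move=> s; rewrite /upd (negPf ta).
move=> s j.
set s1 := upd (upd s o 0) t 0.
have it1 n (x : nat -> nat) : x a = n -> iter n (fun s => upd (upd (upd s a (s a).-1) o
      (upd s a (s a).-1 o).+1) t (upd (upd s a (s a).-1) o (upd s a (s a).-1 o).+1 t).+1) x =1
    upd (upd (upd x a 0) o (x o + n)) t (x t + n).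
  elim: n x => [|n IH] x xa k.
    rewrite /upd /= !addn0; case: eqP => [->//|_]; case: eqP => [->//|_].
    by case: eqP => [->|].
  rewrite iterSr IH /upd ?eqxx ?(negPf a_t) ?(negPf ao) ?(negPf ot) ?(negPf oa)
    ?(negPf ta) ?(negPf to) ?xa // !addSnnS.
  by case: eqP => //; case: eqP => //; case: eqP.
have it2 n (x : nat -> nat) : x t = n -> iter n (fun s => upd (upd s t (s t).-1) a
      (upd s t (s t).-1 a).+1) x =1 upd (upd x t 0) a (x a + n).
  elim: n x => [|n IH] x xa k.
    rewrite /upd /= !addn0; case: eqP => [->//|_].
    by case: eqP => [->|].
  rewrite iterSr IH /upd ?eqxx ?(negPf a_t) ?(negPf ta) ?xa // !addSnnS.
  by case: eqP => //; case: eqP.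
rewrite (it2 _ _ erefl) (functional_extensionality _ _ (it1 _ s1 erefl)) /s1 /upd ?eqxx ?(negPf a_t)
  ?(negPf ao) ?(negPf ot) ?(negPf oa) ?(negPf ta) ?(negPf to) !add0n.
case: (j =P a) => [->|_]; rewrite ?(negPf a_t) ?(negPf ao) ?add0n //.
by case: (j =P t); case: (j =P o).
Qed.

Lemma run_seq_ex (Y : Type) (P : Y -> Prop) (h : Y -> nat -> nat) p q w s s' :
  (forall w t, run p w s t <-> w = [::] /\ exists y, P y /\ t = h y) ->
  run (Seq p q) w s s' <-> exists y, P y /\ run q w (h y) s'.
Proof.
move=> ph; split=> [[w1 [w2 [z [-> /ph[-> [y [Py ->]]] qz]]]]|[y [Py qy]]].
  by exists y.
by exists [::], w, (h y); split=> //; apply/ph; split=> //; exists y.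
Qed.

Lemma run_dec r q w s s' : run (Seq (dec r) q) w s s' <->
  s r != 0 /\ run q w (upd s r (s r).-1) s'.
Proof.
split=> [[w1 [w2 [z [-> [-> sr ->] qz]]]]|[sr qz]] //.
by exists [::], w, (upd s r (s r).-1).
Qed.

Lemma run_zero r q w s s' : run (Seq (zero r) q) w s s' <-> s r = 0 /\ run q w s s'.
Proof.
split=> [[w1 [w2 [z [-> [-> sr ->] qz]]]]|[sr qz]] //.
by exists [::], w, s.
Qed.

Definition clears (base n : nat) : prog := foldr (fun r => Seq (clear r)) Eps (iota base n).

Lemma fn_clears base n :
  fn (clears base n) (fun s j => if base <= j < base + n then 0 else s j).
Proof.
elim: n base => [|n IH] base.
  apply: (@fn_ext _ id) => [w s s'|s j]; first by split=> [[-> ->]|[-> ->]].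
  by case: ifP => //; lia.
apply: (fn_ext (fn_seq (fn_clear base) (IH base.+1))) => s j; rewrite /upd.
by case: (j =P base) => jb; do 2?case: ifP => //; lia.
Qed.

Definition fail : prog := Seq (inc 0) (zero 0).

Lemma run_fail w s s' : ~ run fail w s s'.
Proof. by case=> w1 [w2 [z [_ [_ ->] [_]]]]; rewrite /upd eqxx. Qed.

(* Registers from [base] on are scratch space, assumed and left equal to 0. *)
Fixpoint compile (f : prf) (args : seq nat) (out base : nat) {struct f} : prog :=
  match f with
  | PZero => clear out
  | PSucc =>
    if args is a :: _ then Seq (copy a out base) (inc out) else Seq (clear out) (inc out)
  | PProj i => if i < size args then copy (nth 0 args i) out base else clear out
  | PComp f gs =>
    Seq ((fix compiles gs r := match gs with
          | [::] => Eps
          | g :: hs => Seq (compile g args r (r + size gs)) (compiles hs r.+1)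
          end) gs base)
      (Seq (compile f (iota base (size gs)) out (base + size gs)) (clears base (size gs)))
  | PPrec f g =>
    if args is a :: args then
      Seq (copy a base.+2 base.+3) (Seq (compile f args base.+1 base.+4)
        (Seq (loop base.+2 (Seq (compile g [:: base, base.+1 & args] base.+3 base.+4)
                (Seq (copy base.+3 base.+1 base.+4) (Seq (clear base.+3) (inc base)))))
          (Seq (copy base.+1 out base.+2) (Seq (clear base.+1) (clear base)))))
    else fail
  | PMu f =>
    let c := compile f (base :: args) base.+1 base.+2 in
    Seq (Star (Seq c (Seq (dec base.+1) (Seq (clear base.+1) (inc base)))))
      (Seq c (Seq (zero base.+1) (Seq (copy base out base.+1) (clear base))))
  end.

(** The inner fixpoint of [compile], named to allow induction on the list. *)
Fixpoint compiles (gs : seq prf) (args : seq nat) (r : nat) : prog :=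
  if gs is g :: hs then Seq (compile g args r (r + size gs)) (compiles hs args r.+1)
  else Eps.

Lemma compile_comp f gs args out base : compile (PComp f gs) args out base =
  Seq (compiles gs args base)
    (Seq (compile f (iota base (size gs)) out (base + size gs)) (clears base (size gs))).
Proof. by rewrite /=; congr Seq; elim: gs base => //= g gs IH base; rewrite IH. Qed.

(** Being an equivalence, this also says that where [f] diverges no complete run exists; thus
    termination becomes acceptance. *)
Definition compiled (f : prf) : Prop := forall args out base s,
  all (fun a => a < base) args -> out < base -> out \notin args ->
  (forall r, base <= r -> s r = 0) ->
  forall w s', run (compile f args out base) w s s' <->
    w = [::] /\ exists y, prf_eval f (map s args) y /\ s' = upd s out y.

Lemma map_upd s r y args : r \notin args -> map (upd s r y) args = map s args.
Proof.
move=> rargs; apply/eq_in_map => j jargs; rewrite /upd; case: eqP => // jr.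
by rewrite -jr jargs in rargs.
Qed.

Lemma fresh_notin base r args : all (fun a => a < base) args -> base <= r -> r \notin args.
Proof. by move=> /allP ab br; apply/negP => /ab; lia. Qed.

Lemma all_ltW base b args : base <= b -> all (fun a => a < base) args ->
  all (fun a => a < b) args.
Proof. by move=> bb; apply: sub_all => a ab; apply: leq_trans ab bb. Qed.

Ltac regs z := apply: functional_extensionality => ?; rewrite /upd /=;
  repeat (case: eqP => ?; subst; try lia); rewrite ?z //; lia.

Lemma compiled_total f v out n p h s : fn p h ->
  (forall y, prf_eval f v y <-> y = n) -> h s = upd s out n ->
  forall w s', run p w s s' <-> w = [::] /\ exists y, prf_eval f v y /\ s' = upd s out y.
Proof.
move=> ph fn_ hs w s'; rewrite ph hs; split=> [[-> ->]|[-> [y [/fn_-> ->]]]] //.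
by split=> //; exists n; split=> //; apply/fn_.
Qed.

Lemma compiled_zero : compiled PZero.
Proof.
move=> args out base s ab ob oargs sz.
exact: compiled_total (fn_clear out) (prf_zeroE _) erefl.
Qed.

Lemma compiled_succ : compiled PSucc.
Proof.
move=> [|a args] out base s ab ob oargs sz.
  apply: (compiled_total (fn_seq (fn_clear out) (fn_inc out)) (prf_succE _)).
  by rewrite /=; regs sz.
move: ab oargs; rewrite /= inE negb_or => /andP[ab _] /andP[oa _].
apply: (compiled_total (fn_seq (fn_copy _ _ _) (fn_inc out)) (prf_succE _)); try lia.
by rewrite /=; regs sz.
Qed.

Lemma compiled_proj i : compiled (PProj i).
Proof.
move=> args out base s ab ob oargs sz; rewrite [compile _ _ _ _]/=.
case: ifP => iargs.
  have ia : nth 0 args i \in args by rewrite mem_nth.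
  have := allP ab _ ia => ib.
  have oi : nth 0 args i != out by apply: contraNneq oargs => <-.
  apply: (compiled_total (fn_copy _ _ _) (prf_projE _ _)); try lia.
  by rewrite (nth_map 0) //; regs sz.
apply: (compiled_total (fn_clear out) (prf_projE _ _)).
by rewrite nth_default // size_map leqNgt iargs.
Qed.

Lemma run_compiles gs args r s :
  (forall g, List.In g gs -> compiled g) -> all (fun a => a < r) args ->
  (forall j, r + size gs <= j -> s j = 0) ->
  forall w s', run (compiles gs args r) w s s' <-> w = [::] /\
    exists ys, prf_evals gs (map s args) ys /\
      s' = fun j => if r <= j < r + size gs then nth 0 ys (j - r) else s j.
Proof.
elim: gs r s => [|g gs IH] r s cg ar sz w s'.
  split=> [[-> <-]|[-> [ys [_ ->]]]].
    split=> //; exists [::]; split; first exact: evs_nil.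
    by apply: functional_extensionality => j; rewrite addn0; case: ifP => //; lia.
  split=> //; apply: functional_extensionality => j.
  by rewrite addn0; case: ifP => //; lia.
have rargs := fresh_notin ar (leqnn r).
have /run_seq_ex -> : forall w t, run (compile g args r (r + (size gs).+1)) w s t <->
    w = [::] /\ exists y, prf_eval g (map s args) y /\ t = upd s r y.
  by apply: cg => //=; [left | apply: all_ltW ar; lia | lia].
have IHy y v z : run (compiles gs args r.+1) v (upd s r y) z <-> v = [::] /\
    exists ys, prf_evals gs (map s args) ys /\
    z = fun j => if r <= j < r + (size gs).+1 then nth 0 (y :: ys) (j - r) else s j.
  rewrite IH => [|h hgs||j jr].
  - rewrite map_upd //.
    suff E ys : (fun j => if r < j < r.+1 + size gs then nth 0 ys (j - r.+1) else upd s r y j) =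
        (fun j => if r <= j < r + (size gs).+1 then nth 0 (y :: ys) (j - r) else s j).
      by split=> -[-> [ys [gys ->]]]; split=> //; exists ys; rewrite E.
    apply: functional_extensionality => j; rewrite /upd.
    case: (j =P r) => [->|jr]; first by rewrite ltnn leqnn subnn /= ifT //; lia.
    case: ifP => j1; last by rewrite ifF //; lia.
    by rewrite ifT; [rewrite -[j - r]prednK ?subn_gt0 /= ?subnS //|]; lia.
  - by apply: cg; right.
  - by apply: all_ltW ar.
  - by rewrite /upd; case: eqP => [|_]; [lia | apply: sz => /=; lia].
split=> [[y [gy /IHy[-> [ys [gys ->]]]]]|[-> [yys [/prf_evals_cons[y [ys [-> gy gys]]] ->]]]].
  by split=> //; exists (y :: ys); split=> //; apply: evs_cons.
by exists y; split=> //; apply/IHy; split=> //; exists ys.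
Qed.

Lemma prf_evals_size gs v ys : prf_evals gs v ys -> size ys = size gs.
Proof.
elim: gs ys => [|g gs IH] ys; first by move=> /prf_evals_nil->.
by move=> /prf_evals_cons[y [zs [-> _ /IH /= ->]]].
Qed.

Lemma compiled_comp f gs : compiled f -> (forall g, List.In g gs -> compiled g) ->
  compiled (PComp f gs).
Proof.
move=> cf cg args out base s ab ob oargs sz w s'.
set b := base + size gs; rewrite compile_comp.
have szb j : base + size gs <= j -> s j = 0 by move=> bj; apply: sz; lia.
have /run_seq_ex -> := run_compiles cg ab szb.
pose t ys : nat -> nat := fun j => if base <= j < b then nth 0 ys (j - base) else s j.
have tE ys : size ys = size gs -> map (t ys) (iota base (size gs)) = ys.
  move=> szy; apply: (@eq_from_nth _ 0); rewrite size_map size_iota // => i ig.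
  by rewrite (nth_map 0) ?size_iota // nth_iota // /t ifT ?addKn //; rewrite /b; lia.
have ftE ys v z : size ys = size gs ->
    run (Seq (compile f (iota base (size gs)) out b) (clears base (size gs))) v (t ys) z <->
    v = [::] /\ exists y, prf_eval f ys y /\ z = upd s out y.
  move=> szy.
  have /run_seq_ex -> : forall w z, run (compile f (iota base (size gs)) out b) w (t ys) z <->
      w = [::] /\ exists y, prf_eval f ys y /\ z = upd (t ys) out y.
    rewrite -{2}(tE _ szy); apply: cf.
    - by apply/allP => j; rewrite mem_iota /b; lia.
    - by rewrite /b; lia.
    - by rewrite mem_iota; lia.
    - by move=> j bj; rewrite /t ifF; [apply: sz; rewrite /b in bj; lia | lia].
  have E y : (fun j => if base <= j < base + size gs then 0 else upd (t ys) out y j) = upd s out y.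
    apply: functional_extensionality => j; rewrite /upd /t -/b.
    case: ifP => jb; first by case: eqP => jo; [lia | rewrite sz //; lia].
    by case: eqP => // _; rewrite ifF // -jb.
  split=> [[y [fy /fn_clears[-> ->]]]|[-> [y [fy ->]]]].
    by split=> //; exists y.
  by exists y; split=> //; apply/fn_clears; rewrite E.
split=> [[ys [gys]]|[-> [y [/prf_compE[ys [gys fy]] ->]]]].
  move=> /(ftE _ _ _ (prf_evals_size gys))[-> [y [fy ->]]]; split=> //; exists y.
  by split=> //; apply/prf_compE; exists ys.
exists ys; split=> //; apply/(ftE _ _ _ (prf_evals_size gys)).
by split=> //; exists y.
Qed.

Lemma compiled_prec f g : compiled f -> compiled g -> compiled (PPrec f g).
Proof.
move=> cf cg [|a args] out base s ab ob oargs sz w s'.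
  by split=> [/run_fail //|[_ [y [/prf_prec_nil]]]].
move: ab oargs; rewrite inE negb_or => /andP[ab argsb] /andP[oa oargs].
(* The loop states: [k] steps of the recursion done, current value [r], [m] steps left. *)
pose st k r m := upd (upd (upd s base k) base.+1 r) base.+2 m.
have stargs k r m : map (st k r m) args = map s args.
  by rewrite /st !map_upd //; apply: fresh_notin argsb _; lia.
have stz k r m j : base.+3 <= j -> st k r m j = 0.
  by move=> jb; rewrite /st /upd; do 3?[case: eqP => ?; first by lia]; apply: sz; lia.
rewrite [compile _ _ _ _]/=.
rewrite (run_seq _ _ _ _ (fn_copy _ _ _)); try lia.
set s1 := upd _ _ _.
have cfE v t : run (compile f args base.+1 base.+4) v s1 t <->
    v = [::] /\ exists y, prf_eval f (map s args) y /\ t = st 0 y (s a).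
  have <- : map s1 args = map s args.
    by rewrite /s1 !map_upd //; apply: fresh_notin argsb _; lia.
  have stE y : upd s1 base.+1 y = st 0 y (s a) by rewrite /s1 /st; regs sz.
  have -> : run (compile f args base.+1 base.+4) v s1 t <-> v = [::] /\
      exists y, prf_eval f (map s1 args) y /\ t = upd s1 base.+1 y.
    apply: cf.
    - by apply: all_ltW argsb; lia.
    - by lia.
    - by apply: fresh_notin argsb _; lia.
    - by move=> r br; rewrite /s1 /upd; do 2?[case: eqP => ?; first by lia]; apply: sz; lia.
  by split=> -[-> [y [fy ->]]]; split=> //; exists y; rewrite stE.
have /run_seq_ex -> := cfE.
set body := Seq (compile g _ _ _) _.
have bodyE v k r m t : run body v (st k r m) t <-> v = [::] /\ exists y,
    prf_eval g [:: k, r & map s args] y /\ t = st k.+1 y m.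
  have gE v' t' : run (compile g [:: base, base.+1 & args] base.+3 base.+4) v' (st k r m) t' <->
      v' = [::] /\ exists y, prf_eval g [:: k, r & map s args] y /\ t' = upd (st k r m) base.+3 y.
    have <- : map (st k r m) [:: base, base.+1 & args] = [:: k, r & map s args].
      by rewrite /= stargs /st /upd; do 5?[case: eqP => ?; try lia].
    apply: cg => [|||j jb].
    - by rewrite /= (all_ltW _ argsb) //; lia.
    - by lia.
    - by rewrite !inE !negb_or (fresh_notin argsb) //; lia.
    - by apply: stz; lia.
  have /run_seq_ex -> := gE.
  have fnE := fn_seq (@fn_copy base.+3 base.+1 base.+4 _ _ _)
     (fn_seq (fn_clear base.+3) (fn_inc base)).
  have stE y : st k.+1 y m =
     (let z := upd (upd (upd (upd (st k r m) base.+3 y) base.+1 (upd (st k r m) base.+3 y base.+3))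
        base.+4 0) base.+3 0 in upd z base (z base).+1).
    by rewrite /st; regs sz.
  split=> [[y [gy /fnE]]|[-> [y [gy ->]]]].
    by case; try lia; move=> -> ->; split=> //; exists y; rewrite stE.
  by exists y; split=> //; apply/fnE; try lia; rewrite stE.
pose I t := exists k r m, t = st k r m.
have dec_st k r m : upd (st k r m) base.+2 (st k r m base.+2).-1 = st k r m.-1.
  by rewrite /st; regs sz.
have st2 k r m : st k r m base.+2 = m by rewrite /st /upd eqxx.
have loopE k r m v t : run (loop base.+2 body) v (st k r m) t <-> v = [::] /\
    itr m (fun s s' => run body [::] (upd s base.+2 (s base.+2).-1) s') (st k r m) t.
  suff bI : forall x u z, I x -> x base.+2 != 0 -> run body u (upd x base.+2 (x base.+2).-1) z ->
      [/\ u = [::], z base.+2 = (x base.+2).-1 & I z].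
    by rewrite (loopP bI) ?st2 //; exists k, r, m.
  move=> x u z [k' [r' [m' ->]]] _; rewrite dec_st st2 => /bodyE[-> [y [_ ->]]]; split=> //.
  by exists k'.+1, y, m'.-1.
have tailE r v k t : run (Seq (copy base.+1 out base.+2) (Seq (clear base.+1) (clear base))) v
    (st k r 0) t <-> v = [::] /\ t = upd s out r.
  rewrite (fn_seq (fn_copy _ _ _) (fn_seq (fn_clear base.+1) (fn_clear base))); try lia.
  suff -> : upd (upd (upd (upd (st k r 0) out (st k r 0 base.+1)) base.+2 0) base.+1 0) base 0 =
     upd s out r by [].
  by rewrite /st; regs sz.
rewrite [map s (a :: args)]/=; split.
  move=> [r [fr [w1 [w2 [t [-> /loopE[-> it]]]]]]].
  suff [y [n [yE ->]]] : exists y n, prf_eval (PPrec f g) (s a :: map s args) y /\ t = st n y 0.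
    by move=> /tailE[-> ->]; split=> //; exists y.
  have r0 : prf_eval (PPrec f g) (0 :: map s args) r by apply/prf_prec0.
  suff H m k x : prf_eval (PPrec f g) (k :: map s args) x ->
      itr m (fun s s' => run body [::] (upd s base.+2 (s base.+2).-1) s') (st k x m) t ->
      exists y n, prf_eval (PPrec f g) (k + m :: map s args) y /\ t = st n y 0.
    exact: H r0 it.
  elim: m k x {r fr r0 it} => [|m IH] k r kr /=; first by move=> ->; exists r, k; rewrite addn0.
  move=> [z]; rewrite dec_st => /bodyE[_ [y [gy ->]]] it.
  by rewrite addnS -addSn; apply: IH it; apply/prf_precS; exists r.
move=> [-> [y [yE ->]]].
(* Each step of the recursion is appended at the end of the loop, so the induction keeps [m] passes
   in reserve in the counter. *)
have [r [fr it]] : exists r, prf_eval f (map s args) r /\ forall m,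
    itr (s a) (fun s s' => run body [::] (upd s base.+2 (s base.+2).-1) s')
      (st 0 r (s a + m)) (st (s a) y m).
  elim: (s a) y yE => [|n IH] y; first by move=> /prf_prec0 fy; exists y.
  move=> /prf_precS[r' [/IH[r [fr it]] gy]]; exists r; split=> // m.
  apply: (itrSr (y := st n r' m.+1)); first by rewrite addSnnS.
  by rewrite dec_st; apply/bodyE; split=> //; exists y.
exists r; split=> //; exists [::], [::], (st (s a) y 0); split=> //.
  by apply/loopE; split=> //; rewrite -{2}[s a]addn0.
exact/tailE.
Qed.

(** The number of passes is guessed, but [dec] certifies a nonzero value in every pass and the final
    [zero] certifies a root, so the guess is the least root. *)
Lemma compiled_mu f : compiled f -> compiled (PMu f).
Proof.
move=> cf args out base s ab ob oargs sz w s'.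
set v := map s args; pose st k := upd s base k.
have cE k u t : run (compile f (base :: args) base.+1 base.+2) u (st k) t <->
    u = [::] /\ exists y, prf_eval f (k :: v) y /\ t = upd (st k) base.+1 y.
  have <- : map (st k) (base :: args) = k :: v.
    by rewrite /= /st map_upd ?(fresh_notin ab) // /upd eqxx.
  apply: cf => [|||j jb].
  - by rewrite /= (all_ltW _ ab) //; lia.
  - by lia.
  - by rewrite inE negb_or (fresh_notin ab) //; lia.
  - by rewrite /st /upd; case: eqP => ?; [lia | apply: sz; lia].
have stepE k u t : run (Seq (compile f (base :: args) base.+1 base.+2)
      (Seq (dec base.+1) (Seq (clear base.+1) (inc base)))) u (st k) t <->
    u = [::] /\ (exists r, prf_eval f (k :: v) r.+1) /\ t = st k.+1.
  have /run_seq_ex -> := cE k.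
  have stE y : let z := upd (upd (upd (st k) base.+1 y) base.+1 (upd (st k) base.+1 y base.+1).-1) base.+1 0 in
      upd z base (z base).+1 = st k.+1 by rewrite /st; regs sz.
  split=> [[y [fy /run_dec[y0 /(fn_seq (fn_clear base.+1) (fn_inc base))[-> ->]]]]|[-> [[r fr] ->]]].
    split=> //; rewrite stE; split=> //; exists y.-1; rewrite prednK //.
    by move: y0; rewrite /upd eqxx lt0n.
  exists r.+1; split=> //; apply/run_dec; split; first by rewrite /upd eqxx.
  by apply/(fn_seq (fn_clear base.+1) (fn_inc base)); rewrite stE.
have tailE k u t : run (Seq (compile f (base :: args) base.+1 base.+2)
      (Seq (zero base.+1) (Seq (copy base out base.+1) (clear base)))) u (st k) t <->
    u = [::] /\ prf_eval f (k :: v) 0 /\ t = upd s out k.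
  have /run_seq_ex -> := cE k.
  have fnE := fn_seq (@fn_copy base out base.+1 _ _ _) (fn_clear base).
  have stE : upd (upd (upd (upd (st k) base.+1 0) out (upd (st k) base.+1 0 base)) base.+1 0) base 0 =
      upd s out k by rewrite /st; regs sz.
  split=> [[y [fy /run_zero[]]]|[-> [f0 ->]]].
    rewrite {1}/upd eqxx => y0; rewrite y0 in fy *.
    by move=> /fnE[]; try lia; rewrite stE => -> ->.
  exists 0; split=> //; apply/run_zero; split; first by rewrite /upd eqxx.
  by apply/fnE; try lia; rewrite stE.
have s0 : s = st 0 by rewrite /st; regs sz.
rewrite [compile _ _ _ _]/= {1}s0; split.
  move=> [w1 [w2 [t [-> sR]]]].
  suff [k [-> [-> fk]]] : exists k, w1 = [::] /\ t = st k /\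
      forall z, 0 <= z < k -> exists r, prf_eval f (z :: v) r.+1.
    move=> /tailE[-> [f0 ->]]; split=> //; exists k; split=> //.
    by apply/prf_muE; split.
  suff H n x u : star (run (Seq (compile f (base :: args) base.+1 base.+2)
      (Seq (dec base.+1) (Seq (clear base.+1) (inc base))))) u x t -> x = st n ->
      exists k, u = [::] /\ t = st k /\
      forall z, n <= z < k -> exists r, prf_eval f (z :: v) r.+1 by exact: H sR erefl.
  move=> xR; elim: xR n => {w1 sR x u t} [x n ->|w1 w3 x y z xy _ IH n xE].
    by exists n; split=> //; split=> // z; lia.
  move: xy; rewrite xE => /stepE[-> [fr yE]].
  have [k [-> [-> fk]]] := IH _ yE; exists k; split=> //; split=> // j /andP[nj jk].
  by have [->//|nj'] := eqVneq j n; apply: fk; lia.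
move=> [-> [k [/prf_muE[f0 fk] ->]]].
exists [::], [::], (st k); split=> //; last exact/tailE.
suff H d n : n + d = k -> star (run (Seq (compile f (base :: args) base.+1 base.+2)
      (Seq (dec base.+1) (Seq (clear base.+1) (inc base))))) [::] (st n) (st k) by apply: (H k).
elim: d n => [|d IH] n; first by rewrite addn0 => ->; apply: star_nil.
move=> nd; apply: (@star_cons _ _ _ [::] [::] _ (st n.+1)); last by apply: IH; rewrite addSnnS.
by apply/stepE; split=> //; split=> //; apply: fk; lia.
Qed.

Lemma compileP f : compiled f.
Proof.
apply: prf_nested_ind f.
- exact: compiled_zero.
- exact: compiled_succ.
- exact: compiled_proj.
- exact: compiled_comp.
- exact: compiled_prec.
- exact: compiled_mu.
Qed.

(* Only registers 0 and 1 are in use while the input is read. *)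
Definition pair_state (c m : nat) : nat -> nat := upd (upd (fun=> 0) 0 c) 1 m.

Definition half : prog :=
  Seq (Star (Seq (dec 1) (Seq (dec 1) (inc 2))))
    (Seq (zero 1) (Seq (copy 2 1 3) (clear 2))).

Lemma run_half w c m s' : run half w (pair_state c m) s' <->
  w = [::] /\ exists h, m = h.*2 /\ s' = pair_state c h.
Proof.
have [z z0] : exists z : nat -> nat, forall r, 0 <= r -> z r = 0 by exists (fun=> 0).
pose st m b := upd (pair_state c m) 2 b.
have stepE u k b t : run (Seq (dec 1) (Seq (dec 1) (inc 2))) u (st k b) t <->
    u = [::] /\ exists j, k = j.+2 /\ t = st j b.+1.
  have stE j : upd (upd (upd (st j.+2 b) 1 j.+1) 1 j) 2 b.+1 = st j b.+1.
    by rewrite /st /pair_state; regs z0.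
  split=> [/run_dec[k0 /run_dec[k1 [-> ->]]]|[-> [j [-> ->]]]].
    split=> //; exists k.-2; case: k k0 k1 => [|[|k]] // _ _.
  by apply/run_dec; split=> //; apply/run_dec; split=> //; split=> //; rewrite -stE.
have tailE u k b t : run (Seq (zero 1) (Seq (copy 2 1 3) (clear 2))) u (st k b) t <->
    u = [::] /\ k = 0 /\ t = pair_state c b.
  have stE : upd (upd (upd (st 0 b) 1 b) 3 0) 2 0 = pair_state c b.
    by rewrite /st /pair_state; regs z0.
  have fnE := fn_seq (@fn_copy 2 1 3 erefl erefl erefl) (fn_clear 2).
  split=> [/run_zero[k0 /fnE[-> ->]]|[-> [-> ->]]].
    by split=> //; split; [exact: k0 | have {}k0 : k = 0 := k0; rewrite k0 -stE].
  by apply/run_zero; split=> //; apply/fnE; rewrite -stE.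
have s0 : pair_state c m = st m 0 by rewrite /st /pair_state; regs z0.
rewrite s0; split.
  move=> [w1 [w2 [t [-> sR tR]]]].
  suff H u x : star (run (Seq (dec 1) (Seq (dec 1) (inc 2)))) u x t -> forall k b, x = st k b ->
      exists j h, [/\ u = [::], k = h.*2 + j & t = st j (b + h)].
    have [j [h [-> -> tE]]] := H _ _ sR _ _ erefl; move: tR; rewrite tE => /tailE[-> [-> ->]].
    by split=> //; exists h; rewrite addn0.
  move=> xR; elim: xR => {w1 sR u x t tR} [x k b ->|w1 w3 x y t xy _ IH k b xE].
    by exists k, 0; rewrite addn0.
  move: xy; rewrite xE => /stepE[-> [j [-> yE]]].
  have [j' [h [-> -> ->]]] := IH _ _ yE; exists j', h.+1.
  by split=> //; rewrite ?doubleS ?addSnnS.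
move=> [-> [h [-> ->]]]; exists [::], [::], (st 0 h); split=> //; last exact/tailE.
suff H b : star (run (Seq (dec 1) (Seq (dec 1) (inc 2)))) [::] (st h.*2 b) (st 0 (b + h)).
  exact: (H 0).
elim: h b => [|h IH] b; first by rewrite addn0; apply: star_nil.
apply: (@star_cons _ _ _ [::] [::] _ (st h.*2 b.+1)).
  by apply/stepE; split=> //; exists h.*2.
by rewrite -addSnnS; apply: IH.
Qed.

(** Takes the head [n] off a code, [CodeSeq.code (n :: s)] being [2 ^ n * (CodeSeq.code s).*2.+1];
    it is blocked on any other head. *)
Fixpoint uncons (n : nat) : prog :=
  if n is n.+1 then Seq half (uncons n) else Seq (dec 1) half.

Lemma run_uncons n w c m s' : run (uncons n) w (pair_state c m) s' <->
  w = [::] /\ exists k, m = 2 ^ n * k.*2.+1 /\ s' = pair_state c k.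
Proof.
elim: n m w s' => [|n IH] m w s'; rewrite [uncons _]/=.
  have stE k : upd (pair_state c k.+1) 1 k = pair_state c k.
    by apply: functional_extensionality => j; rewrite /pair_state /upd; case: eqP.
  split=> [/run_dec[]|[-> [k [-> ->]]]].
    have -> : pair_state c m 1 = m by [].
    case: m => // m _; rewrite stE => /run_half[-> [h [-> ->]]].
    by split=> //; exists h; rewrite mul1n.
  by apply/run_dec; split=> //; rewrite mul1n stE; apply/run_half; split=> //; exists k.
have /run_seq_ex -> : forall u t, run half u (pair_state c m) t <-> u = [::] /\
    exists h, m = h.*2 /\ t = pair_state c h by move=> u t; apply: run_half.
split=> [[h [-> /IH[-> [k [-> ->]]]]]|[-> [k [-> ->]]]].
  by split=> //; exists k; rewrite expnS -mulnA mul2n.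
exists (2 ^ n * k.*2.+1); split; first by rewrite expnS -mulnA mul2n.
by apply/IH; split=> //; exists k.
Qed.

Definition read_letter (a : S) : prog := Seq (Atom (Read a)) (uncons (pickle a)).
Definition read_word : prog := Star (foldr (fun a => Alt (read_letter a)) fail (enum S)).

Lemma run_alts (T : eqType) (h : T -> prog) l w s s' :
  run (foldr (fun a => Alt (h a)) fail l) w s s' <-> exists2 a, a \in l & run (h a) w s s'.
Proof.
elim: l => [|a l IH]; first by split=> [/run_fail//|[]].
split=> [[ha|/IH[b bl hb]]|[b]].
- by exists a; rewrite ?mem_head.
- by exists b; rewrite // inE bl orbT.
- by rewrite inE => /orP[/eqP->|bl hb]; [left | right; apply/IH; exists b].
Qed.

Lemma run_read_word w c m s' : run read_word w (pair_state c m) s' <->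
  exists k, m = foldr (fun n m => 2 ^ n * m.*2.+1) k (map pickle w) /\ s' = pair_state c k.
Proof.
have letterE u k t : run (foldr (fun a => Alt (read_letter a)) fail (enum S)) u (pair_state c k) t <->
    exists a, u = [:: a] /\ exists j, k = 2 ^ pickle a * j.*2.+1 /\ t = pair_state c j.
  rewrite run_alts; split=> [[a _ [w1 [w2 [x [-> [-> ->] /run_uncons[-> kj]]]]]]|[a [-> kj]]].
    by exists a.
  exists a; first by rewrite mem_enum.
  by exists [:: a], [::], (pair_state c k); split=> //; apply/run_uncons.
split.
  suff H x : star (run (foldr (fun a => Alt (read_letter a)) fail (enum S))) w x s' ->
      forall m, x = pair_state c m ->
      exists k, m = foldr (fun n m => 2 ^ n * m.*2.+1) k (map pickle w) /\ s' = pair_state c k.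
    by move=> /H; apply.
  elim=> {w x s' m} [x m ->|w1 w2 x y t xy _ IH m xE]; first by exists m.
  move: xy; rewrite xE => /letterE[a [-> [j [-> yE]]]].
  by have [k [-> ->]] := IH _ yE; exists k.
move=> [k [-> ->]]; elim: w => [|a w IH] /=; first exact: star_nil.
apply: (@star_cons _ _ _ [:: a] w _ (pair_state c (foldr (fun n m => 2 ^ n * m.*2.+1) k (map pickle w)))) => //.
apply/letterE; exists a; split=> //.
by exists (foldr (fun n m => 2 ^ n * m.*2.+1) k (map pickle w)).
Qed.

Lemma run_guess w s' : run (Star (inc 0)) w (fun=> 0) s' <->
  w = [::] /\ exists c, True /\ s' = pair_state c 0.
Proof.
have [z z0] : exists z : nat -> nat, forall r, 0 <= r -> z r = 0 by exists (fun=> 0).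
have stE c : upd (pair_state c 0) 0 c.+1 = pair_state c.+1 0.
  by rewrite /pair_state; regs z0.
have s0 : (fun=> 0) = pair_state 0 0 by rewrite /pair_state; regs z0.
rewrite s0; split.
  suff H x : star (run (inc 0)) w x s' -> forall c, x = pair_state c 0 ->
      w = [::] /\ exists c, True /\ s' = pair_state c 0 by move=> /H; apply.
  elim=> {w x s'} [x c ->|w1 w2 x y t [-> yE] _ IH c xE]; first by split=> //; exists c.
  by apply: (IH c.+1); rewrite yE xE -stE.
move=> [-> [c [_ ->]]].
suff H n : star (run (inc 0)) [::] (pair_state n 0) (pair_state (n + c) 0) by exact: (H 0).
elim: c n => [|c IH] n.
  by rewrite addn0; apply: star_nil.
apply: (@star_cons _ _ _ [::] [::] _ (pair_state n.+1 0)); first by rewrite -stE.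
by rewrite -addSnnS; apply: IH.
Qed.

(** The code of a word has its first letter outermost, so it cannot simply be built up from left to
    right. It is guessed in advance instead; a copy is taken apart while the input is read and must
    end at 0, and then [f] runs on the original. *)
Lemma RE_in_LG (G : Mat -> Prop) (L : seq S -> Prop) :
  matrix_group G -> contains_SL4Z G -> RE_lang L -> in_LG G L.
Proof.
move=> gG GS [f fL].
have [z z0] : exists z : nat -> nat, forall r, 0 <= r -> z r = 0 by exists (fun=> 0).
pose main : prog := Seq (Star (inc 0)) (Seq (copy 0 1 2) (Seq read_word (Seq (zero 1)
  (Seq (compile f [:: 0] 1 2) (Seq (clear 1) (clear 0)))))).
suff mainE w s : run main w (fun=> 0) s <-> L w /\ s = fun=> 0.
  by apply: (@register_in_LG S G main L gG GS) => w => [s /mainE[]|Lw] //; apply/mainE.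
have /run_seq_ex -> := run_guess.
have copyE c : upd (upd (pair_state c 0) 1 c) 2 0 = pair_state c c.
  by rewrite /pair_state; regs z0.
have tailE v c k t : run (Seq (zero 1) (Seq (compile f [:: 0] 1 2) (Seq (clear 1) (clear 0)))) v
    (pair_state c k) t <->
    [/\ v = [::], k = 0, exists y, prf_eval f [:: c] y & t = fun=> 0].
  rewrite run_zero.
  have -> : pair_state c k 1 = k by [].
  case: k => [|k]; last by split=> [[]|[]].
  have /run_seq_ex -> : forall u t, run (compile f [:: 0] 1 2) u (pair_state c 0) t <->
      u = [::] /\ exists y, prf_eval f [:: c] y /\ t = upd (pair_state c 0) 1 y.
    by apply: (compileP f) => // [[|[|r]]].
  have clE y : upd (upd (upd (pair_state c 0) 1 y) 1 0) 0 0 = fun=> 0.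
    by rewrite /pair_state; regs z0.
  have fnE := fn_seq (fn_clear 1) (fn_clear 0).
  split=> [[_ [y [fy /fnE[-> ->]]]]|[-> _ [y fy] ->]].
    by split; rewrite ?clE //; exists y.
  by split=> //; exists y; split=> //; apply/fnE; rewrite clE.
have codeE : pickle w = foldr (fun n m => 2 ^ n * m.*2.+1) 0 (map pickle w) by [].
move: tailE {main}; move: (Seq (zero 1) _) => tail tailE.
rewrite fL; split=> [[c [_]]|[fy ->]].
  rewrite (run_seq _ _ _ _ (@fn_copy 0 1 2 erefl erefl erefl)) copyE.
  move=> [w1 [w2 [t [wE]]]] /run_read_word[k [cE ->]] tR.
  have [w20 k0 fy ->] := proj1 (tailE _ _ _ _) tR.
  by split=> //; rewrite codeE wE w20 cats0; rewrite k0 in cE; rewrite -cE.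
exists (pickle w); split=> //.
rewrite (run_seq _ _ _ _ (@fn_copy 0 1 2 erefl erefl erefl)) copyE.
exists w, [::], (pair_state (pickle w) 0); rewrite cats0; split=> //.
  by apply/run_read_word; exists 0.
exact/tailE.
Qed.
End Compilation.

(** * Integer polynomials *)

Section IntegerPolynomials.
Local Open Scope ring_scope.

Inductive zexp : Type :=
| ZConst of int
| ZVar of nat
| ZAdd of zexp & zexp
| ZMul of zexp & zexp.

(** The reading of constants is a parameter since [absz], which is no ring morphism, is wanted as
    well: it gives the majorant [meval]. *)
Fixpoint zeval (R : nzSemiRingType) (cst : int -> R) (env : seq R) (e : zexp) : R :=
  match e with
  | ZConst z => cst z
  | ZVar i => env`_i
  | ZAdd a b => zeval cst env a + zeval cst env b
  | ZMul a b => zeval cst env a * zeval cst env b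
  end.

Definition zsum (es : seq zexp) : zexp := foldr ZAdd (ZConst 0) es.

Lemma zeval_zsum (R : nzSemiRingType) (cst : int -> R) env es : cst 0 = 0 ->
  zeval cst env (zsum es) = \sum_(e <- es) zeval cst env e.
Proof.
move=> c0; elim: es => [|e es IH]; first by rewrite big_nil.
by rewrite big_cons /= IH.
Qed.

(* The coefficient of [ZVar 0 ^+ j], the other variables being renumbered. *)
Fixpoint coefexp (j : nat) (e : zexp) : zexp :=
  match e with
  | ZConst z => ZConst (if j == 0%N then z else 0)
  | ZVar 0 => ZConst (if j == 1%N then 1 else 0)
  | ZVar i.+1 => if j == 0%N then ZVar i else ZConst 0
  | ZAdd a b => ZAdd (coefexp j a) (coefexp j b)
  | ZMul a b => zsum [seq ZMul (coefexp i a) (coefexp (j - i) b) | i <- index_iota 0 j.+1]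
  end.

Definition zpoly (R : nzSemiRingType) (cst : int -> R) (env : seq R) (e : zexp) : {poly R} :=
  zeval (fun z => (cst z)%:P) ('X :: map polyC env) e.

Lemma coef_zpoly (R : nzSemiRingType) (cst : int -> R) env e j : cst 0 = 0 -> cst 1 = 1 ->
  (zpoly cst env e)`_j = zeval cst env (coefexp j e).
Proof.
move=> c0 c1; rewrite /zpoly; elim: e j => [z|[|i]|a IHa b IHb|a IHa b IHb] j; last 1 first.
- rewrite [zeval _ _ _]/= coefM.
  rewrite -[coefexp _ _]/(zsum [seq ZMul (coefexp i a) (coefexp (j - i) b) | i <- index_iota 0 j.+1]).
  rewrite zeval_zsum // big_map big_mkord.
  by apply: eq_bigr => i _; rewrite IHa IHb.
all: rewrite /=.
- by rewrite coefC; case: (j == 0%N).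
- by rewrite coefX; case: (j == 1%N).
- have [ie|ie] := ltnP i (size env).
    by rewrite (nth_map 0) // coefC; case: (j == 0%N).
  by rewrite [(map _ _)`_i]nth_default ?size_map // coef0; case: (j == 0%N); rewrite /= ?nth_default.
- by rewrite coefD IHa IHb.
Qed.

Lemma horner_zpoly (R : comNzSemiRingType) (cst : int -> R) z env e :
  zeval cst (z :: env) e = (zpoly cst env e).[z].
Proof.
rewrite /zpoly; elim: e => [c|[|i]|a IHa b IHb|a IHa b IHb] /=.
- by rewrite hornerC.
- by rewrite hornerX.
- have [ie|ie] := ltnP i (size env); first by rewrite (nth_map 0) // hornerC.
  by rewrite !nth_default ?size_map // horner0.
- by rewrite hornerD IHa IHb.
- by rewrite hornerM IHa IHb.
Qed.

Lemma zeval_intr (R : nzRingType) (env : seq int) e :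
  zeval (fun z => z%:~R : R) [seq z%:~R | z <- env] e = (zeval id env e)%:~R.
Proof.
elim: e => [c|i|a IHa b IHb|a IHa b IHb] //=.
- have [ie|ie] := ltnP i (size env); first by rewrite (nth_map 0).
  by rewrite !nth_default ?size_map.
- by rewrite intrD IHa IHb.
- by rewrite intrM IHa IHb.
Qed.

Definition meval (env : seq nat) (e : zexp) : nat := zeval absz env e.

Lemma zeval_le_meval (env : seq nat) e :
  (absz (zeval id [seq Posz n | n <- env] e) <= meval env e)%N.
Proof.
rewrite /meval; elim: e => [c|i|a IHa b IHb|a IHa b IHb] //=.
- have [ie|ie] := ltnP i (size env); first by rewrite (nth_map 0%N) ?absz_nat.
  by rewrite nth_default ?size_map.
- apply: leq_trans (leq_add IHa IHb).
  set x := zeval _ _ _; set y := zeval _ _ _; lia.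
- by rewrite abszM leq_mul.
Qed.

Lemma sum_coef_le (p : {poly nat}) n : (\sum_(j < n) (p`_j)%R <= (p.[1])%R)%N.
Proof.
rewrite (horner_coef_wide (n := maxn n (size p))) ?leq_maxr //.
under [leqRHS]eq_bigr do rewrite expr1n mulr1.
rewrite -!(big_mkord xpredT (fun i => p`_i)) (big_cat_nat (leq0n n) (leq_maxl _ _)) /=.
exact: leq_addr.
Qed.

(** Over the naturals the value at 1 is the sum of all coefficients; putting a variable to 1 in the
    majorant bounds the coefficients in that variable at once. *)
Lemma sum_meval_coefexp n env e :
  (\sum_(j < n) meval env (coefexp j e) <= meval (1%N :: env) e)%N.
Proof.
rewrite /meval horner_zpoly; apply: leq_trans (sum_coef_le _ n).
by apply: leq_sum => j _; rewrite coef_zpoly.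
Qed.

(** A Cauchy bound: at such an [a] the leading term outweighs all the others together. *)
Lemma root_gt_coefs (p : {poly int}) (a : nat) :
  (\sum_(j < size p) absz (p`_j)%R < a)%N -> p.[a%:Z] = 0 -> p = 0.
Proof.
move=> pa pa0; apply/eqP/negPn/negP => p0.
have : (0 < size p)%N by rewrite size_poly_gt0.
case sp : (size p) => [//|n] _.
have ln : lead_coef p = p`_n by rewrite lead_coefE sp.
rewrite sp big_ord_recr /= in pa.
have lead0 : p`_n != 0 by rewrite -ln lead_coef_eq0.
move: pa0; rewrite horner_coef sp big_ord_recr /= => /eqP; rewrite addr_eq0 => /eqP sE.
set s := \sum_(i < n) _ in sE.
set t := (\sum_(i < n) _)%N in pa.
(* The factor [a] avoids the exponent [n - 1], which would be wrong for [n = 0]. *)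
have sle : (absz s * a <= t * a ^ n)%N.
  have : (absz s <= \sum_(i < n) absz (p`_i)%R * a ^ i)%N.
    rewrite /s; elim/big_ind2: _ => // [x x' y y' xx yy|i _].
      by apply: leq_trans (leq_add xx yy); lia.
    by rewrite abszM abszX.
  move=> /(leq_mul (leqnn a)) sl; rewrite mulnC (leq_trans sl) //.
  rewrite big_distrr big_distrl /=; apply: leq_sum => i _.
  by rewrite mulnCA -expnS leq_mul2l leq_pexp2l ?orbT //; lia.
have ab : absz s = (absz (p`_n)%R * a ^ n)%N by rewrite sE abszN abszM abszX.
have an : (0 < a ^ n)%N by rewrite expn_gt0; lia.
have : (t * a ^ n < absz s * a)%N; last by rewrite ltnNge sle.
rewrite ab mulnAC ltn_mul2r an /=.
have : (0 < absz (p`_n)%R)%N by rewrite absz_gt0.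
by move: pa; nia.
Qed.

(** The value [a] of variable [m] exceeds the majorant of [e] with 1 for that variable and the [m]
    before it. This bounds the coefficients that remain once those [m] variables have been split
    off. *)
Fixpoint dominates (m : nat) (T : seq nat) (e : zexp) : Prop :=
  if T is a :: T then (meval (nseq m.+1 1%N ++ T) e < a)%N /\ dominates m.+1 T e
  else True.

Lemma dominates_coefexp m T e j : dominates m.+1 T e -> dominates m T (coefexp j e).
Proof.
elim: T m => //= a T IH m [ea eT]; split; last exact: IH.
apply: leq_ltn_trans ea; apply: leq_trans (sum_meval_coefexp j.+1 _ _).
by rewrite big_ord_recr /= leq_addl.
Qed.

Definition Zring (t : seq C) (x : C) : Prop := exists e, x = zeval (fun z => z%:~R) t e.

(** Algebraic independence over Q: taking coefficients in Z[t] gives the same notion, by clearing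
    denominators. *)
Fixpoint alg_indep (t : seq C) : Prop :=
  if t is z :: t then
    alg_indep t /\ forall p : {poly C}, (forall j, Zring t p`_j) -> root p z -> p = 0
  else True.

(** Each side says that all coefficients in the first variable vanish: over C because [z] is
    transcendental over the rest, over Z because [a] exceeds the sum of the coefficients. The
    coefficients are compared by induction. *)
Lemma zeval_specialize t T e : size t = size T -> alg_indep t -> dominates 0 T e ->
  zeval (fun z => z%:~R) t e = 0 <-> zeval id [seq Posz n | n <- T] e = 0.
Proof.
elim: t T e => [|z t IH] [|a T] e //=.
  by rewrite -[[::]]/[seq z%:~R | z <- [::]] zeval_intr => _ _ _; split=> [/eqP|->//]; rewrite intr_eq0 => /eqP.
move=> [tT] [it tz] [ea eT]; rewrite !horner_zpoly.
set p := zpoly _ _ _; set q := zpoly _ _ _.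
have pq j : p`_j = 0 <-> q`_j = 0.
  by rewrite !coef_zpoly //; apply: IH => //; apply: dominates_coefexp.
have pE : p.[z] = 0 <-> p = 0.
  split=> [/rootP|->]; last by rewrite horner0.
  by apply: tz => j; exists (coefexp j e); rewrite coef_zpoly.
have qE : q.[a%:Z] = 0 <-> q = 0.
  split=> [|->]; last by rewrite horner0.
  apply: root_gt_coefs; apply: leq_ltn_trans ea; apply: leq_trans (sum_meval_coefexp (size q) _ _).
  by apply: leq_sum => j _; rewrite coef_zpoly //; apply: zeval_le_meval.
rewrite pE qE; split=> [p0|q0]; apply/polyP => j; rewrite coef0; apply/pq; first by rewrite p0 coef0.
by rewrite q0 coef0.
Qed.
End IntegerPolynomials.

(** * Matrices over a purely transcendental extension *)

Section FieldOfDefinition.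
Local Open Scope ring_scope.

Lemma Zring_int t (z : int) : Zring t z%:~R.
Proof. by exists (ZConst z). Qed.

Lemma ZringD t x y : Zring t x -> Zring t y -> Zring t (x + y).
Proof. by move=> [a ->] [b ->]; exists (ZAdd a b). Qed.

Lemma ZringM t x y : Zring t x -> Zring t y -> Zring t (x * y).
Proof. by move=> [a ->] [b ->]; exists (ZMul a b). Qed.

Lemma ZringN t x : Zring t x -> Zring t (- x).
Proof. by move=> tx; rewrite -mulN1r -[-1]/((-1)%:~R); apply: ZringM tx; apply: Zring_int. Qed.

Lemma ZringX t x n : Zring t x -> Zring t (x ^+ n).
Proof.
move=> tx; elim: n => [|n IH]; first exact: (Zring_int _ 1).
by rewrite exprS; apply: ZringM.
Qed.

Lemma Zring_sum (I : Type) (r : seq I) (P : pred I) (F : I -> C) t :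
  (forall i, P i -> Zring t (F i)) -> Zring t (\sum_(i <- r | P i) F i).
Proof. by move=> tF; apply: big_ind => //; [apply: (Zring_int _ 0) | apply: ZringD]. Qed.

Lemma Zring_mem t x : x \in t -> Zring t x.
Proof. by move=> /(nthP 0)[i _ <-]; exists (ZVar i). Qed.

Lemma Zring_sub t u x : (forall y, y \in t -> Zring u y) -> Zring t x -> Zring u x.
Proof.
move=> tu [e ->]; elim: e => [z|i|a IHa b IHb|a IHa b IHb] /=.
- exact: Zring_int.
- have [it|it] := ltnP i (size t); first by apply: tu; rewrite mem_nth.
  by rewrite nth_default //; apply: (Zring_int _ 0).
- exact: ZringD.
- exact: ZringM.
Qed.

Lemma Zring_mono t u x : {subset t <= u} -> Zring t x -> Zring u x.
Proof. by move=> tu; apply: Zring_sub => y /tu; apply: Zring_mem. Qed.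

Lemma Zring_cons z t x : Zring (z :: t) x ->
  exists2 p : {poly C}, forall j, Zring t p`_j & x = p.[z].
Proof.
move=> [e ->]; exists (zpoly (fun z => z%:~R) t e) => [j|]; last exact: horner_zpoly.
by rewrite coef_zpoly //; exists (coefexp j e).
Qed.

Variables (J : finType) (M : J -> Mat).

(* The matrices [M j] act faithfully on the span of the rows [E i], through
   matrices with entries in the fraction field of Z[t]; the elements of
   [rest] are those still to be eliminated from the entries. *)
Definition represents (t rest : seq C) (I : finType) (E : I -> 'rV[C]_4) (q : C)
    (N : J -> I -> I -> C) : Prop :=
  [/\ q != 0, Zring t q, forall j i k, Zring (t ++ rest) (N j i k),
    forall j i, q *: (E i *m M j) = \sum_k N j i k *: E k &
    forall X : Mat, (forall i, E i *m X = E i) -> X = 1%:M].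

Definition representable t rest : Prop :=
  exists (I : finType) (E : I -> 'rV[C]_4) q N, @represents t rest I E q N.

Lemma representable_entries : exists rest, representable [::] rest.
Proof.
exists [seq M j p.1 p.2 | j <- enum J, p <- enum [the finType of ('I_4 * 'I_4)%type]].
exists 'I_4, (fun i => delta_mx 0 i), 1, (fun j i k => M j i k); split.
- exact: oner_neq0.
- exact: (Zring_int _ 1).
- move=> j i k; apply: Zring_mem; apply/allpairsP; exists (j, (i, k)).
  by rewrite !mem_enum.
- by move=> j i; rewrite scale1r -rowE [LHS]row_sum_delta; apply: eq_bigr => k _; rewrite mxE.
- by move=> X XE; apply/row_matrixP => i; rewrite rowE XE row1.
Qed.

Lemma representable_transcendental t z rest :
  representable t (z :: rest) -> representable (z :: t) rest.
Proof.
move=> [I [E [q [N [q0 tq tN EN EX]]]]]; exists I, E, q, N; split=> //.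
  by apply: Zring_mono tq => x; rewrite inE orbC => ->.
move=> j i k; apply: Zring_mono (tN j i k) => x.
by rewrite !(mem_cat, inE) => /orP[->|/orP[->|->]]; rewrite ?orbT.
Qed.

(* Multiplying by a power of the leading coefficient avoids denominators. *)
Lemma pseudo_power t z (p : {poly C}) m : (forall j, Zring t p`_j) -> root p z ->
  exists r : {poly C}, [/\ (size r <= (size p).-1)%N, forall j, Zring t r`_j &
    r.[z] = lead_coef p ^+ m.+1 * z ^+ m].
Proof.
move=> tp pz.
have [-> |p0] := eqVneq p 0.
  (* With the exponent [m.+1] the right-hand side is 0 here even when [m = 0]. *)
  exists 0; split=> [|j|]; rewrite ?size_poly0 ?coef0 //; first exact: (Zring_int _ 0).
  by rewrite lead_coef0 exprS !mul0r horner0.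
have [sp1|sp1] := leqP (size p) 1.
  move: pz p0; rewrite (size1_polyC sp1) /root hornerC polyC_eq0 => /eqP->.
  by rewrite eqxx.
case sp : (size p) sp1 => [|[|d]] //= _.
elim: m => [|m [r [sr tr rz]]].
  exists (lead_coef p)%:P; split=> [|j|].
  - by rewrite (leq_trans (size_polyC_leq1 _)).
  - by rewrite coefC; case: (j == 0%N); [rewrite lead_coefE | exact: (Zring_int _ 0)].
  - by rewrite hornerC expr1 mulr1.
(* A step of pseudo-division: the terms of degree [d.+1] cancel, and the multiple of [p] vanishes at
   [z]. *)
exists (lead_coef p *: (r * 'X) - r`_d *: p); split=> [|j|].
- apply/leq_sizeP => j dj; rewrite coefB !coefZ coefMX.
  have -> : (j == 0)%N = false by case: j dj.
  have [<-|jd] := eqVneq d.+1 j.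
    by rewrite /= lead_coefE sp /= mulrC subrr.
  have {jd}dj' : (d.+1 < j)%N by rewrite ltn_neqAle jd.
  rewrite (nth_default 0 (s := p)) ?sp // mulr0 subr0 nth_default ?mulr0 //.
  by apply: leq_trans sr _; case: j dj' {dj}.
- rewrite coefB !coefZ coefMX; apply: ZringD; last by apply: ZringN; apply: ZringM.
  apply: ZringM; first by rewrite lead_coefE.
  by case: (j == 0%N); [exact: (Zring_int _ 0) | ].
- rewrite hornerD hornerN !hornerZ hornerMX rz (rootP pz) mulr0 subr0.
  by rewrite [_ ^+ m.+2]exprS [z ^+ m.+1]exprSr !mulrA.
Qed.

(** The rows [E i] are replaced by [z ^+ e *: E i] with [e] below the degree of [p]. An entry is a
    polynomial in [z], and its product with [z ^+ e] is reduced to low powers of [z] by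
    [pseudo_power]. Since [p] may be reducible, the new rows may be dependent. *)
Lemma representable_algebraic t z rest (p : {poly C}) :
  (forall j, Zring t p`_j) -> root p z -> p != 0 ->
  representable t (z :: rest) -> representable t rest.
Proof.
move=> tp pz p0 [I [E [q [N [q0 tq tN EN EX]]]]].
have [|P PN] := @fin_all_exists [the finType of (J * I * I)%type] (fun=> {poly C})
    (fun x p => (forall f, Zring (t ++ rest) p`_f) /\ N x.1.1 x.1.2 x.2 = p.[z]).
  move=> [[j i] k] /=.
  have : Zring (z :: t ++ rest) (N j i k).
    by apply: Zring_mono (tN j i k) => x; rewrite !(mem_cat, inE) orbCA.
  by move=> /Zring_cons[r tr rz]; exists r.
(* The powers of [z] to be reduced are [f + e] with [f < D] and [e < d], all below [D + d]. *)
pose D := \max_x size (P x); pose d := (size p).-1; pose c := lead_coef p.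
have sp : (1 < size p)%N.
  rewrite ltnNge; apply/negP => sp1; move: pz p0.
  by rewrite (size1_polyC sp1) /root hornerC polyC_eq0 => /eqP->; rewrite eqxx.
have d0 : (0 < d)%N by rewrite /d; lia.
have c0 : c != 0 by rewrite lead_coef_eq0.
have tc : Zring t c by rewrite /c lead_coefE.
have tmono x : Zring t x -> Zring (t ++ rest) x.
  by apply: Zring_mono => y yt; rewrite mem_cat yt.
have [|R RP] := @fin_all_exists 'I_(D + d) (fun=> {poly C}) (fun m r =>
    [/\ (size r <= d)%N, forall j, Zring t r`_j & r.[z] = c ^+ (D + d) * z ^+ m]).
  move=> m.
  have [r [sr tr rz]] := pseudo_power m tp pz.
  (* Raises the exponent of [c] to a common value, giving one denominator for all powers. *)
  exists (c ^+ (D + d - m.+1) *: r); split=> [|j|].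
  - exact: leq_trans (size_scale_leq _ _) sr.
  - by rewrite coefZ; apply: ZringM => //; apply: ZringX.
  - by rewrite hornerZ rz mulrA -exprD subnK.
have Rlt (e : 'I_d) (f : 'I_D) : (f + e < D + d)%N by move: (ltn_ord e) (ltn_ord f); lia.
exists [the finType of (I * 'I_d)%type], (fun x : I * 'I_d => z ^+ x.2 *: E x.1), (q * c ^+ (D + d)).
exists (fun j (x y : I * 'I_d) => \sum_(f < D) (P (j, x.1, y.1))`_f * (R (Ordinal (Rlt x.2 f)))`_y.2).
split.
- by rewrite mulf_neq0 // expf_neq0.
- by apply: ZringM => //; apply: ZringX.
- move=> j x y; apply: Zring_sum => f _; apply: ZringM; first by case: (PN (j, x.1, y.1)).
  by apply: tmono; case: (RP (Ordinal (Rlt x.2 f))).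
- move=> j [i e] /=.
  have kE k : c ^+ (D + d) * z ^+ e * N j i k = \sum_(e' < d)
      (\sum_(f < D) (P (j, i, k))`_f * (R (Ordinal (Rlt e f)))`_e') * z ^+ e'.
    under eq_bigr do rewrite big_distrl /=.
    rewrite exchange_big /=.
    have [_ /= ->] := PN (j, i, k).
    rewrite (horner_coef_wide (n := D)); last exact: (leq_bigmax (j, i, k)).
    rewrite big_distrr; apply: eq_bigr => f _ /=.
    have [sR _ RE] := RP (Ordinal (Rlt e f)).
    under eq_bigr do rewrite -mulrA.
    rewrite -big_distrr /= -horner_coef_wide // RE /= [z ^+ (f + e)]exprD.
    by rewrite mulrCA [z ^+ f * _]mulrC !mulrA.
  rewrite -(pair_bigA _ (fun k (e' : 'I_d) =>
    (\sum_(f < D) (P (j, i, k))`_f * (R (Ordinal (Rlt e f)))`_e') *: (z ^+ e' *: E k))) /=.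
  transitivity ((c ^+ (D + d) * z ^+ e) *: (q *: (E i *m M j))).
    by rewrite -scalemxAl !scalerA; congr (_ *: _); rewrite -mulrA mulrC.
  rewrite EN scaler_sumr; apply: eq_bigr => k _.
  by rewrite scalerA kE scaler_suml; apply: eq_bigr => e' _; rewrite scalerA.
- move=> X XE; apply: EX => i; have := XE (i, Ordinal d0).
  by rewrite /= expr0 !scale1r.
Qed.

Lemma exists_representation : exists t, alg_indep t /\ representable t [::].
Proof.
have [rest rep] := representable_entries.
suff H t : alg_indep t -> representable t rest ->
    exists u, alg_indep u /\ representable u [::] by apply: H rep.
elim: rest t {rep} => [|z rest IH] t it rep; first by exists t.
(* Whether [z] is algebraic over the chosen [t] is settled by excluded middle; only existence of the
   data is wanted. *)
have [[p [tp pz p0]]|nalg] := classic (exists p : {poly C},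
    [/\ forall j, Zring t p`_j, root p z & p != 0]).
  exact: IH it (representable_algebraic tp pz p0 rep).
apply: (IH (z :: t)); last exact: representable_transcendental.
split=> // p tp pz; apply/eqP/negPn/negP => p0.
by apply: nalg; exists p.
Qed.

(* A family of least cardinality is linearly independent: a relation lets one
   of its rows be dropped. *)
Lemma exists_free_representation t : representable t [::] ->
  exists (I : finType) (E : I -> 'rV[C]_4) q N, @represents t [::] I E q N /\
    forall a : I -> C, (forall i, Zring t (a i)) -> \sum_i a i *: E i = 0 -> forall i, a i = 0.
Proof.
move=> [I [E [q [N]]]]; move: {2}#|I| (leqnn #|I|) => n.
elim: n I E q N => [|n IH] I E q N cI rep.
  exists I, E, q, N; split=> // a _ _ i.
  by move: cI; rewrite leqn0 => /eqP/card0_eq/(_ i).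
have [free|] := classic (forall a : I -> C, (forall i, Zring t (a i)) ->
    \sum_i a i *: E i = 0 -> forall i, a i = 0); first by exists I, E, q, N.
move=> /not_all_ex_not[a nfree].
have ta : forall i, Zring t (a i) by apply: NNPP => H; apply: nfree => /H.
have aE : \sum_i a i *: E i = 0 by apply: NNPP => H; apply: nfree => _ /H.
have [i0 ai0] : exists i0, a i0 != 0.
  apply: NNPP => H; apply: nfree => _ _ i; apply/eqP/negPn/negP => ai.
  by apply: H; exists i.
have {}aE : a i0 *: E i0 = - \sum_(i in predC1 i0) a i *: E i.
  by apply/eqP; rewrite -addr_eq0; apply/eqP; rewrite -[RHS]aE [RHS](bigD1 i0).
case: rep => q0 tq tN EN EX; rewrite cats0 in tN.
pose I' := {i | i \in predC1 i0}.
(* The equations are multiplied by [a i0], and [a i0 *: E i0] is replaced through the relation by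
   the remaining rows. *)
apply: (IH I' (fun i => E (val i)) (q * a i0)
  (fun j i k => a i0 * N j (val i) (val k) - N j (val i) i0 * a (val k))).
  by rewrite card_sig; move: cI; rewrite (cardD1 i0) inE add1n ltnS; apply: leq_trans; apply: subset_leq_card; apply/subsetP => x; rewrite !inE => ->.
split.
- by rewrite mulf_neq0.
- exact: ZringM.
- move=> j i k; rewrite cats0; apply: ZringD; first exact: ZringM.
  by apply: ZringN; apply: ZringM.
- move=> j i.
  rewrite -(big_sub (predC1 i0) (fun k => (a i0 * N j (val i) k - N j (val i) i0 * a k) *: E k)).
  rewrite mulrC -scalerA EN (bigD1 i0) //= scalerDr scalerA mulrC -scalerA aE.
  rewrite scalerN scaler_sumr scaler_sumr addrC -sumrN -big_split /=.
  by apply: eq_bigr => k _; rewrite scalerBl !scalerA.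
- move=> X XE; apply: EX => i.
  have {}XE k : k \in predC1 i0 -> E k *m X = E k by move=> ki0; apply: (XE (exist _ k ki0)).
  have [->|] := eqVneq i i0; last exact: XE.
  apply: (scalerI ai0); rewrite scalemxAl aE mulNmx mulmx_suml; congr (- _).
  by apply: eq_bigr => k ki0; rewrite -scalemxAl XE.
Qed.
End FieldOfDefinition.

(** * The word problem of a linear group *)

Section WordExpressions.
Local Open Scope ring_scope.

Definition word_mx (R : pzSemiRingType) n (J : Type) (M : J -> 'M[R]_n) (w : seq J) : 'M[R]_n :=
  foldl (fun A j => A *m M j) 1%:M w.

Lemma word_mx_rcons (R : pzSemiRingType) n (J : Type) (M : J -> 'M[R]_n) w j :
  word_mx M (rcons w j) = word_mx M w *m M j.
Proof. by rewrite /word_mx foldl_rcons. Qed.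

Variables (J K : finType) (ne : J -> K -> K -> zexp).

Definition step_exp (A : K -> K -> zexp) (j : J) (i k : K) : zexp :=
  zsum [seq ZMul (A i l) (ne j l k) | l <- enum K].

Definition word_exp (w : seq J) : K -> K -> zexp :=
  foldl step_exp (fun i k => ZConst (i == k)%:Z) w.

Lemma word_exp_rcons w j : word_exp (rcons w j) = step_exp (word_exp w) j.
Proof. by rewrite /word_exp foldl_rcons. Qed.

Lemma zeval_step_exp (R : nzSemiRingType) (cst : int -> R) env A j i k : cst 0 = 0 ->
  zeval cst env (step_exp A j i k) =
  \sum_l zeval cst env (A i l) * zeval cst env (ne j l k).
Proof. by move=> c0; rewrite /step_exp zeval_zsum // big_map big_enum. Qed.

(* Vanishing of all of these means that the word matrix is scalar. *)
Definition diff_exp (o : K) (w : seq J) (i k : K) : zexp :=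
  ZAdd (word_exp w i k) (ZMul (ZConst (- (i == k)%:Z)) (word_exp w o o)).

Lemma zeval_diff_exp (R : nzRingType) env o w i k :
  zeval (fun z => z%:~R : R) env (diff_exp o w i k) = 0 <->
  zeval (fun z => z%:~R) env (word_exp w i k) =
    (i == k)%:R * zeval (fun z => z%:~R) env (word_exp w o o).
Proof.
rewrite /= mulrNz mulNr; split=> [/eqP|->]; last by rewrite mulrb; case: (i == k); rewrite subrr.
by rewrite subr_eq0 => /eqP->; case: (i == k).
Qed.

(** Bounds every row sum of majorants, so each letter of a word costs one factor. The successor
    makes it positive, so that its powers grow with the exponent. *)
Definition height (env : seq nat) : nat :=
  (\sum_(x : J * K * K) meval env (ne x.1.1 x.1.2 x.2)).+1%N.

Lemma meval_word_exp env w i k : (meval env (word_exp w i k) <= height env ^ size w)%N.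
Proof.
elim/last_ind: w i k => [|w j IH] i k; first by rewrite /meval /=; case: (i == k).
rewrite word_exp_rcons /meval zeval_step_exp // -/(meval _ _) size_rcons expnSr.
apply: (@leq_trans (\sum_l height env ^ size w * meval env (ne j l k)))%N.
  by apply: leq_sum => l _; apply: leq_mul => //; apply: IH.
rewrite -big_distrr /= leq_mul2l; apply/orP; right.
rewrite /height; apply: leqW.
rewrite -(pair_bigA _ (fun (x : J * K) k => meval env (ne x.1 x.2 k))) /=.
rewrite -(pair_bigA _ (fun j i => \sum_k meval env (ne j i k)))%N /=.
rewrite [leqRHS](bigD1 j) //=; apply: leq_trans (leq_addr _ _).
by apply: leq_sum => l _; rewrite (bigD1 k) //= leq_addr.
Qed.

(** Two word entries, each at most [height env ^ c]: this is the source of the values in [tower]. *)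
Lemma meval_diff_exp env o w i k c : (size w <= c)%N ->
  (meval env (diff_exp o w i k) < (height env ^ c).*2.+1)%N.
Proof.
move=> wc; rewrite ltnS /meval /= -!/(meval _ _).
have hc x y : (meval env (word_exp w x y) <= height env ^ c)%N.
  by apply: leq_trans (meval_word_exp _ _ _ _) _; rewrite leq_pexp2l.
rewrite -addnn; apply: leq_add => //; apply: leq_trans (hc o o).
by case: (i == k); rewrite /= ?mul1r ?mul0r.
Qed.

(* Values for the transcendental variables, each dominating a polynomial in
   the earlier ones, so that no expression for a word of length at most [c]
   vanishes by accident; [r] is the number of variables of the environment. *)
Fixpoint tower (r c m : nat) : seq nat :=
  if m is m.+1 then
    let T := tower r c m in
    ((height (nseq (r - m) 1%N ++ T) ^ c).*2.+1)%N :: T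
  else [::].

Lemma size_tower r c m : size (tower r c m) = m.
Proof. by elim: m => //= m ->. Qed.

Lemma dominates_tower r c m o w i k : (size w <= c)%N -> (m <= r)%N ->
  dominates (r - m) (tower r c m) (diff_exp o w i k).
Proof.
move=> wc; elim: m => // m IH mr.
have rm : ((r - m.+1).+1 = r - m)%N by lia.
by split; rewrite rm; [apply: meval_diff_exp | apply: IH; lia].
Qed.

(** Recursive functions compute on naturals, so an integer is kept as a difference; [b = true]
    selects the part to be subtracted. *)
Fixpoint pev (b : bool) (env : seq nat) (e : zexp) : nat :=
  match e with
  | ZConst z => if b == (z < 0) then absz z else 0%N
  | ZVar i => if b then 0%N else nth 0%N env i
  | ZAdd x y => (pev b env x + pev b env y)%N
  | ZMul x y => (pev true env x * pev (~~ b) env y + pev false env x * pev b env y)%N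
  end.

Lemma zeval_pev env e :
  zeval id [seq Posz n | n <- env] e = (pev false env e)%:Z - (pev true env e)%:Z.
Proof.
elim: e => [z|i|a IHa b IHb|a IHa b IHb] /=.
- by case: (ltrP z 0) => z0 /=; lia.
- rewrite subr0; have [ie|ie] := ltnP i (size env); first by rewrite (nth_map 0%N).
  by rewrite !nth_default ?size_map.
- by rewrite IHa IHb; lia.
- by rewrite IHa IHb; lia.
Qed.

Lemma pev_zsum b env es : pev b env (zsum es) = (\sum_(e <- es) pev b env e)%N.
Proof.
elim: es => [|e es IH]; first by rewrite big_nil /=; case: b.
by rewrite big_cons /= IH.
Qed.

Lemma pev_step_exp b env A j i k : pev b env (step_exp A j i k) =
  (\sum_l (pev true env (A i l) * pev (~~ b) env (ne j l k) +
           pev false env (A i l) * pev b env (ne j l k)))%N.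
Proof. by rewrite /step_exp pev_zsum big_map big_enum. Qed.
End WordExpressions.

Section WordProblem.
Local Open Scope ring_scope.
Variables (J : finType) (M : J -> Mat).

(** If the word is 1, freeness of the rows over Z[t] forces the product of numerators to be
    [q ^+ size w] times the identity; conversely, that equation fixes all rows, and faithfulness
    applies. *)
Lemma exists_word_exp : exists t, alg_indep t /\
  exists (K : finType) (o : K) (ne : J -> K -> K -> zexp), forall w,
    word_mx M w = 1%:M <->
    forall i k, zeval (fun z => z%:~R) t (diff_exp ne o w i k) = 0.
Proof.
have [t [it rep]] := exists_representation M; exists t; split=> //.
have [I [E0 [q [N0 [[q0 tq tN EN0 EX0] free0]]]]] := exists_free_representation rep.
rewrite cats0 in tN; have [qe qE] := tq.
have [ne NE] : exists ne : J * I * I -> zexp, forall x,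
    N0 x.1.1 x.1.2 x.2 = zeval (fun z => z%:~R) t (ne x).
  apply: (@fin_all_exists [the finType of (J * I * I)%type] (fun=> zexp)
    (fun x e => N0 x.1.1 x.1.2 x.2 = zeval (fun z => z%:~R) t e)) => x.
  exact: tN.
(* The extra coordinate [None] carries [q], so its diagonal entry is [q ^+ size w] and the criterion
   becomes that a single matrix be scalar. *)
pose K := option I.
pose nh j (x y : K) : zexp := match x, y with
  | Some i, Some k => ne (j, i, k)
  | None, None => qe
  | _, _ => ZConst 0
  end.
exists [the finType of K], None, nh => w.
pose ev := zeval (fun z => z%:~R : C) t.
have evS w1 j i k : ev (word_exp nh (rcons w1 j) i k) =
    \sum_l ev (word_exp nh w1 i l) * ev (nh j l k).
  by rewrite word_exp_rcons [LHS]zeval_step_exp.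
have big_option (F : K -> C) : \sum_l F l = F None + \sum_i F (Some i).
  rewrite (bigD1 None) //=; congr (_ + _); rewrite (reindex_omap Some id) => [|[]] //=.
  by apply: eq_bigl => i; rewrite eqxx.
have Wz v i : ev (word_exp nh v None (Some i)) = 0 /\ ev (word_exp nh v (Some i) None) = 0.
  elim/last_ind: v i => [|v j IH] i; first by rewrite /ev /= mulr0z.
  rewrite !evS !big_option !big1 => [|k _|k _]; rewrite ?(proj1 (IH _)) ?mul0r //.
    by rewrite !addr0 (proj2 (IH i)) mul0r /ev /= mulr0z mulr0.
  by rewrite /ev /= mulr0z mulr0.
have Wq : ev (word_exp nh w None None) = q ^+ size w.
  elim/last_ind: w => [|v j IH]; first by rewrite /ev /= expr0.
  rewrite evS big_option big1 => [|i _]; last by rewrite (proj1 (Wz v i)) mul0r.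
  by rewrite addr0 IH size_rcons exprSr qE.
have WE i : q ^+ size w *: (E0 i *m word_mx M w) =
    \sum_k ev (word_exp nh w (Some i) (Some k)) *: E0 k.
  elim/last_ind: w i {Wq} => [|w j IH] i.
    rewrite expr0 scale1r mulmx1 (bigD1 i) //= big1 => [|k ki].
      by rewrite /ev /= eqxx scale1r addr0.
    by rewrite /ev /= (inj_eq Some_inj) eq_sym (negPf ki) scale0r.
  rewrite word_mx_rcons size_rcons exprS -scalerA mulmxA scalemxAl IH.
  rewrite mulmx_suml scaler_sumr.
  under eq_bigr do rewrite -scalemxAl scalerA mulrC -scalerA EN0 scaler_sumr.
  rewrite exchange_big /=; apply: eq_bigr => k _.
  rewrite evS big_option (proj2 (Wz w i)) mul0r add0r scaler_suml.
  by apply: eq_bigr => l _; rewrite scalerA (NE (j, l, k)).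
have dE i k : ev (diff_exp nh None w i k) = 0 <->
    ev (word_exp nh w i k) = (i == k)%:R * ev (word_exp nh w None None).
  exact: zeval_diff_exp.
split=> [Mw [i|] [k|]|H].
- apply/dE; rewrite Wq; apply/eqP; rewrite -subr_eq0; apply/eqP.
  move: k; apply: free0 => [k|].
    rewrite -[Zring _ _]/(Zring t _); apply: ZringD; first by exists (word_exp nh w (Some i) (Some k)).
    by apply: ZringN; apply: ZringM; [apply: (Zring_int _ (_ == _)%:Z) | apply: ZringX].
  under eq_bigr do rewrite scalerBl.
  rewrite sumrB -WE Mw mulmx1 (bigD1 i) //= eqxx mul1r big1 ?addr0 ?subrr // => k ki.
  by rewrite (inj_eq Some_inj) eq_sym (negPf ki) mul0r scale0r.
- by apply/dE; rewrite (proj2 (Wz w i)) mul0r.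
- by apply/dE; rewrite (proj1 (Wz w k)) mul0r.
- by apply/dE; rewrite eqxx mul1r.
apply: EX0 => i; apply: (scalerI (expf_neq0 (size w) q0)); rewrite WE (bigD1 i) //= big1 => [|k ki].
  by rewrite addr0 (proj1 (dE _ _) (H (Some i) (Some i))) eqxx mul1r Wq.
by rewrite (proj1 (dE _ _) (H (Some i) (Some k))) (inj_eq Some_inj) eq_sym (negPf ki) mul0r scale0r.
Qed.
End WordProblem.

(** The bound [c] is separate from [w] because the test will use a code of the word in place of its
    length. *)
Lemma word_problem_pev (J : finType) (M : J -> Mat) :
  exists (r : nat) (K : finType) (o : K) (ne : J -> K -> K -> zexp), forall c w,
    size w <= c -> word_mx M w = 1%:M%R <->
    forall i k, let T := tower ne r c r in
      pev false T (word_exp ne w i k) + (i == k) * pev true T (word_exp ne w o o) =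
      pev true T (word_exp ne w i k) + (i == k) * pev false T (word_exp ne w o o).
Proof.
have [t [it [K [o [ne wE]]]]] := exists_word_exp M.
exists (size t), K, o, ne => c w wc; rewrite wE.
have dom i k : dominates 0 (tower ne (size t) c (size t)) (diff_exp ne o w i k).
  by rewrite -(subnn (size t)); apply: dominates_tower.
have szT : size t = size (tower ne (size t) c (size t)) by rewrite size_tower.
suff H i k : zeval (fun z => z%:~R)%R t (diff_exp ne o w i k) = 0%R <->
    let T := tower ne (size t) c (size t) in
      pev false T (word_exp ne w i k) + (i == k) * pev true T (word_exp ne w o o) =
      pev true T (word_exp ne w i k) + (i == k) * pev false T (word_exp ne w o o).
  by split=> D i k; apply/H.
rewrite (zeval_specialize szT it (dom i k)) zeval_pev /=.
set a := pev _ _ _; set b := pev _ _ _; set x := pev _ _ _; set y := pev _ _ _.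
by case: (i == k); rewrite /=; lia.
Qed.

(** * Closure properties of recursive functions *)

Lemma In_mem (T : eqType) (x : T) s : List.In x s <-> x \in s.
Proof.
elim: s => [|y s IH] //=; rewrite inE eq_sym.
by split=> [[->|/IH->]|/orP[/eqP|/IH]]; rewrite ?eqxx ?orbT //; [left | right].
Qed.

Section RecursiveFunctions.

Definition PR (k : nat) (F : seq nat -> nat) : Prop :=
  exists p, forall v, size v = k -> prf_eval p v (F v).

Lemma PR_ext k F F' : (forall v, size v = k -> F v = F' v) -> PR k F -> PR k F'.
Proof. by move=> FF [p pF]; exists p => v vk; rewrite -FF //; apply: pF. Qed.

Lemma PR_nth k i : PR k (fun v => nth 0 v i).
Proof. by exists (PProj i) => v _; apply/prf_projE. Qed.

Lemma PR_comp k F (Gs : seq (seq nat -> nat)) : PR (size Gs) F ->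
  (forall G, List.In G Gs -> PR k G) -> PR k (fun v => F [seq G v | G <- Gs]).
Proof.
move=> [p pF] PG.
suff [ps psG] : exists ps, forall v, size v = k -> prf_evals ps v [seq G v | G <- Gs].
  exists (PComp p ps) => v vk; apply/prf_compE; exists [seq G v | G <- Gs].
  by split; [apply: psG | apply: pF; rewrite size_map].
elim: Gs PG {pF} => [|G Gs IH] PG; first by exists [::] => v _; apply: evs_nil.
have [|ps psG] := IH; first by move=> H HG; apply: PG; right.
have [|q qG] := PG G; first by left.
by exists (q :: ps) => v vk; apply: evs_cons; [apply: qG | apply: psG].
Qed.

Lemma PR_comp1 (f : nat -> nat) k F : PR 1 (fun v => f (nth 0 v 0)) -> PR k F ->
  PR k (fun v => f (F v)).
Proof.
move=> Pf PF; apply: (@PR_comp k _ [:: F] Pf) => G /=.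
by case=> [<-|[]].
Qed.

Lemma PR_comp2 (f : nat -> nat -> nat) k F G :
  PR 2 (fun v => f (nth 0 v 0) (nth 0 v 1)) -> PR k F -> PR k G ->
  PR k (fun v => f (F v) (G v)).
Proof.
move=> Pf PF PG; apply: (@PR_comp k _ [:: F; G] Pf) => H /=.
by case=> [<-|[<-|[]]].
Qed.

Lemma PR_succ k F : PR k F -> PR k (fun v => (F v).+1).
Proof. by apply: (@PR_comp1 S); exists PSucc => v _; apply/prf_succE. Qed.

Lemma PR_const k c : PR k (fun=> c).
Proof.
elim: c => [|c IH]; last exact: PR_succ IH.
by exists PZero => v _; apply/prf_zeroE.
Qed.

Lemma PR_rec k N A B : PR k N -> PR k A -> PR k.+2 B ->
  PR k (fun v => nat_rect (fun=> nat) (A v) (fun n r => B [:: n, r & v]) (N v)).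
Proof.
move=> PN [a aA] [b bB].
pose F u := nat_rect (fun=> nat) (A (behead u)) (fun n r => B [:: n, r & behead u]) (nth 0 u 0).
have PF : PR k.+1 F.
  exists (PPrec a b) => -[//|n v] [vk]; rewrite /F /=.
  elim: n => [|n IH] /=; first by apply: ev_prec0; apply: aA.
  by apply: ev_precS IH _; apply: bB; rewrite /= vk.
pose Gs := N :: [seq (fun u => nth 0 u i) | i <- iota 0 k].
apply: (@PR_ext _ (fun v => F [seq G v | G <- Gs])) => [v vk|].
  have E : [seq G v | G <- [seq (fun u => nth 0 u i) | i <- iota 0 k]] = v.
    by rewrite -map_comp -[RHS](mkseq_nth 0) vk.
  by rewrite /F /= E.
apply: PR_comp => [|G]; first by rewrite /= size_map size_iota.
by case=> [<-//|/List.in_map_iff[i [<- _]]]; apply: PR_nth.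
Qed.

Lemma PR_mu k F G : PR k.+1 G ->
  (forall v, size v = k -> G (F v :: v) = 0 /\ forall z, z < F v -> G (z :: v) != 0) ->
  PR k F.
Proof.
move=> [g gG] FG; exists (PMu g) => v vk; have [G0 Gn] := FG v vk.
apply/prf_muE; split; first by rewrite -G0; apply: gG; rewrite /= vk.
move=> z /Gn; rewrite -lt0n => Gz; exists (G (z :: v)).-1.
by rewrite prednK //; apply: gG; rewrite /= vk.
Qed.

Lemma PR_add k F G : PR k F -> PR k G -> PR k (fun v => F v + G v).
Proof.
apply: (@PR_comp2 addn).
apply: PR_ext (PR_rec (PR_nth 2 1) (PR_nth 2 0) (PR_succ (PR_nth 4 1))) => v _.
by elim: (nth 0 v 1) => [|n IH] /=; rewrite ?addn0 // addnS -IH.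
Qed.

Lemma PR_mul k F G : PR k F -> PR k G -> PR k (fun v => F v * G v).
Proof.
apply: (@PR_comp2 muln).
apply: PR_ext (PR_rec (PR_nth 2 1) (PR_const 2 0) (PR_add (PR_nth 4 1) (PR_nth 4 2))) => v _.
by elim: (nth 0 v 1) => [|n IH] /=; rewrite ?muln0 // mulnS -IH addnC.
Qed.

Lemma PR_exp k F G : PR k F -> PR k G -> PR k (fun v => F v ^ G v).
Proof.
apply: (@PR_comp2 expn).
apply: PR_ext (PR_rec (PR_nth 2 1) (PR_const 2 1) (PR_mul (PR_nth 4 1) (PR_nth 4 2))) => v _.
by elim: (nth 0 v 1) => [|n IH] //=; rewrite expnSr -IH.
Qed.

Lemma PR_pred k F : PR k F -> PR k (fun v => (F v).-1).
Proof.
apply: (@PR_comp1 predn).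
apply: PR_ext (PR_rec (PR_nth 1 0) (PR_const 1 0) (PR_nth 3 0)) => v _.
by case: (nth 0 v 0).
Qed.

Lemma PR_sub k F G : PR k F -> PR k G -> PR k (fun v => F v - G v).
Proof.
apply: (@PR_comp2 subn).
apply: PR_ext (PR_rec (PR_nth 2 1) (PR_nth 2 0) (PR_pred (PR_nth 4 1))) => v _.
by elim: (nth 0 v 1) => [|n IH] /=; rewrite ?subn0 // subnS -IH.
Qed.

Lemma PR_eq k F G : PR k F -> PR k G -> PR k (fun v => F v == G v).
Proof.
move=> PF PG; apply: PR_ext (PR_sub (PR_const k 1)
  (PR_add (PR_sub PF PG) (PR_sub PG PF))) => v _.
by case: eqP => /=; lia.
Qed.

Lemma PR_andb k (F G : seq nat -> bool) : PR k F -> PR k G -> PR k (fun v => F v && G v).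
Proof. by move=> PF PG; apply: PR_ext (PR_mul PF PG) => v _; case: (F v); case: (G v). Qed.

Lemma PR_negb k (F : seq nat -> bool) : PR k F -> PR k (fun v => ~~ F v).
Proof. by move=> PF; apply: PR_ext (PR_sub (PR_const k 1) PF) => v _; case: (F v). Qed.

Lemma PR_orb k (F G : seq nat -> bool) : PR k F -> PR k G -> PR k (fun v => F v || G v).
Proof.
move=> PF PG; apply: PR_ext (PR_negb (PR_andb (PR_negb PF) (PR_negb PG))) => v _.
by rewrite negb_and !negbK.
Qed.

Lemma PR_if k (B : seq nat -> bool) F G : PR k B -> PR k F -> PR k G ->
  PR k (fun v => if B v then F v else G v).
Proof.
move=> PB PF PG; apply: PR_ext (PR_add (PR_mul PB PF) (PR_mul (PR_negb PB) PG)) => v _.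
by case: (B v); rewrite ?mul1n ?mul0n ?addn0.
Qed.

Lemma PR_sum (I : Type) (r : seq I) k (F : I -> seq nat -> nat) :
  (forall i, PR k (F i)) -> PR k (fun v => \sum_(i <- r) F i v).
Proof.
move=> PF; elim: r => [|i r IH].
  by apply: PR_ext (PR_const k 0) => v _; rewrite big_nil.
by apply: PR_ext (PR_add (PF i) IH) => v _; rewrite big_cons.
Qed.

Lemma PR_div k F G : PR k F -> PR k G -> PR k (fun v => F v %/ G v).
Proof.
apply: (@PR_comp2 divn).
(* The least [z] with [x < z.+1 * d]; the last factor stops the search at 0 when [d = 0], as [divn]
   requires. *)
apply: (@PR_mu _ _ (fun u => ((nth 0 u 1).+1 - (nth 0 u 0).+1 * nth 0 u 2) * nth 0 u 2)).
  apply: PR_mul (PR_nth _ _); apply: PR_sub; first exact: PR_succ (PR_nth _ _).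
  by apply: PR_mul (PR_nth _ _); apply: PR_succ (PR_nth _ _).
move=> [|x [|d [|//]]] //= _; case: d => [|d]; first by rewrite muln0; split=> // z; rewrite divn0.
split; first by have := ltn_ceil x (ltn0Sn d); nia.
move=> z zx; have := leq_trunc_div x d.+1; nia.
Qed.

Lemma PR_mod k F G : PR k F -> PR k G -> PR k (fun v => F v %% G v).
Proof.
move=> PF PG; apply: PR_ext (PR_sub PF (PR_mul (PR_div PF PG) PG)) => v _.
by have := divn_eq (F v) (G v); lia.
Qed.

Definition hd_code (x : nat) : nat := head 0 (CodeSeq.decode x).
Definition tl_code (x : nat) : nat := CodeSeq.code (behead (CodeSeq.decode x)).

Lemma PR_hd_code k F : PR k F -> PR k (fun v => hd_code (F v)).
Proof.
apply: (@PR_comp1 hd_code).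
(* The head is the exponent of 2 in the code: the least [z] such that [2 ^ z.+1] does not divide it.
   The term [1 - x] stops the search at 0 for the empty list. *)
apply: (@PR_mu _ _ (fun u => 1 - (nth 0 u 1 %% 2 ^ (nth 0 u 0).+1 + (1 - nth 0 u 1)))).
  apply: PR_sub (PR_const _ _) _; apply: PR_add; last exact: PR_sub (PR_const _ _) (PR_nth _ _).
  by apply: PR_mod (PR_nth _ _) _; apply: PR_exp (PR_const _ _) (PR_succ (PR_nth _ _)).
move=> [|x [|//]] //= _; rewrite /hd_code.
have := CodeSeq.decodeK x; case: (CodeSeq.decode x) => [|n s] /= <-; first by rewrite mod0n.
set m := (CodeSeq.code s).*2.+1; have n0 : 0 < 2 ^ n * m by rewrite muln_gt0 expn_gt0.
split=> [|z zn].
  suff : 0 < (2 ^ n * m) %% 2 ^ n.+1 by lia.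
  by rewrite lt0n -/(_ %| _) expnSr dvdn_pmul2l ?expn_gt0 // dvdn2 /m /= odd_double.
have -> : (2 ^ n * m) %% 2 ^ z.+1 = 0 by apply/eqP; rewrite -/(_ %| _) dvdn_mulr // dvdn_exp2l.
by lia.
Qed.

Lemma PR_tl_code k F : PR k F -> PR k (fun v => tl_code (F v)).
Proof.
move=> PF; apply: PR_ext (PR_div PF (PR_exp (PR_const k 2) (PR_succ (PR_hd_code PF)))) => v _.
move: (F v) => x; rewrite /hd_code /tl_code.
have := CodeSeq.decodeK x; case: (CodeSeq.decode x) => [|n s] /= <-; first by rewrite div0n.
by rewrite expnSr divnMl ?expn_gt0 // divn2 /= uphalf_double.
Qed.

Lemma PR_code k (Gs : seq (seq nat -> nat)) : (forall G, List.In G Gs -> PR k G) ->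
  PR k (fun v => CodeSeq.code [seq G v | G <- Gs]).
Proof.
elim: Gs => [|G Gs IH] PG; first exact: PR_const.
apply: PR_mul.
  by apply: PR_exp (PR_const _ _) _; apply: PG; left.
apply: PR_succ; apply: PR_ext (PR_add (IH _) (IH _)) => [v _||]; first exact: addnn.
  by move=> H HG; apply: PG; right.
by move=> H HG; apply: PG; right.
Qed.

Lemma PR_select k (Fs : seq (seq nat -> nat)) D I : PR k D ->
  (forall F, List.In F Fs -> PR k F) -> PR k I -> PR k (fun v => nth D Fs (I v) v).
Proof.
move=> PD; elim: Fs I => [|F Fs IH] I PF PI.
  by apply: PR_ext PD => v _; rewrite nth_nil.
apply: PR_ext (PR_if (PR_eq PI (PR_const k 0)) (PF F (or_introl erefl))
  (IH (fun v => (I v).-1) (fun G HG => PF G (or_intror HG)) (PR_pred PI))) => v _.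
by case: (I v).
Qed.

Definition PRvec (k m : nat) (G : seq nat -> seq nat) : Prop :=
  (forall v, size v = k -> size (G v) = m) /\ forall i, i < m -> PR k (fun v => nth 0 (G v) i).

Lemma PRvec_comp k m F G : PRvec k m G -> PR m F -> PR k (fun v => F (G v)).
Proof.
move=> [sG PG] PF; pose Gs := [seq (fun v => nth 0 (G v) i) | i <- iota 0 m].
apply: (@PR_ext _ (fun v => F [seq H v | H <- Gs])) => [v vk|].
  by rewrite -map_comp -[in RHS](mkseq_nth 0 (G v)) sG.
apply: PR_comp => [|H]; first by rewrite size_map size_iota.
by move=> /List.in_map_iff[i [<- /In_mem]]; rewrite mem_iota => im; apply: PG.
Qed.

Lemma PRvec_code k m G : PRvec k m G -> PR k (fun v => CodeSeq.code (G v)).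
Proof.
move=> [sG PG]; pose Gs := [seq (fun v => nth 0 (G v) i) | i <- iota 0 m].
apply: (@PR_ext _ (fun v => CodeSeq.code [seq H v | H <- Gs])) => [v vk|].
  by rewrite -map_comp -[in RHS](mkseq_nth 0 (G v)) sG.
apply: PR_code => H /List.in_map_iff[i [<- /In_mem]].
by rewrite mem_iota => im; apply: PG.
Qed.

Lemma code_iter_tl s i : iter i tl_code (CodeSeq.code s) = CodeSeq.code (drop i s).
Proof.
elim: i s => [|i IH] s; first by rewrite drop0.
by rewrite iterS IH /tl_code CodeSeq.codeK -drop1 drop_drop add1n.
Qed.

Lemma PR_decode k F i : PR k F -> PR k (fun v => nth 0 (CodeSeq.decode (F v)) i).
Proof.
move=> PF; have Pi : PR k (fun v => iter i tl_code (F v)).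
  by elim: i => [|i IH] //; apply: PR_tl_code IH.
apply: PR_ext (PR_hd_code Pi) => v _.
by rewrite -{1}[F v]CodeSeq.decodeK code_iter_tl /hd_code CodeSeq.codeK -nth0 nth_drop addn0.
Qed.

(** Primitive recursion carries one number, so the state vector is packed by [CodeSeq.code] between
    steps. *)
Lemma PRvec_iter k m N init step : PRvec k m init -> PRvec (m + k) m step -> PR k N ->
  PRvec k m (fun v => iter (N v) (fun s => step (s ++ v)) (init v)).
Proof.
move=> [si Pi] [ss Ps] PN.
have sit v n : size v = k -> size (iter n (fun s => step (s ++ v)) (init v)) = m.
  by move=> vk; elim: n => [|n IH] /=; [apply: si | apply: ss; rewrite size_cat IH vk].
split=> [v vk|i im]; first exact: sit.
pose arg u := mkseq (nth 0 (CodeSeq.decode (nth 0 u 1))) m ++ drop 2 u.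
have Parg : PRvec k.+2 (m + k) arg.
  split=> [u uk|j jm]; first by rewrite size_cat size_mkseq size_drop uk; lia.
  apply: (@PR_ext _ (if j < m then (fun u => nth 0 (CodeSeq.decode (nth 0 u 1)) j)
      else fun u => nth 0 u (2 + (j - m)))) => [u _|].
    rewrite nth_cat size_mkseq; case: ifP => jm'; first by rewrite nth_mkseq.
    by rewrite nth_drop.
  by case: ifP => _; [apply: PR_decode (PR_nth _ _) | apply: PR_nth].
have Pstep : PRvec k.+2 m (fun u => step (arg u)).
  split=> [u uk|j jm]; first by apply: ss; rewrite (proj1 Parg).
  exact: (PRvec_comp Parg (Ps j jm)).
apply: PR_ext (PR_decode i (PR_rec PN (PRvec_code (conj si Pi)) (PRvec_code Pstep))) => v vk.
have -> : nat_rect (fun=> nat) (CodeSeq.code (init v))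
    (fun n r => CodeSeq.code (step (arg [:: n, r & v]))) (N v) =
    CodeSeq.code (iter (N v) (fun s => step (s ++ v)) (init v)).
  elim: (N v) => [|n IH] //; rewrite iterS [LHS]/= IH /arg /= drop0; congr (CodeSeq.code (step (_ ++ _))).
  by rewrite CodeSeq.codeK -[m](sit v n vk) mkseq_nth.
by rewrite CodeSeq.codeK.
Qed.
End RecursiveFunctions.

(** * Simulation of automata *)

Section Simulation.

Lemma prf_eval_det f v y y' : prf_eval f v y -> prf_eval f v y' -> y = y'.
Proof.
elim/prf_nested_ind: f v y y' => [||i|f gs IHf IHgs|f g IHf IHg|f IHf] v y y'.
- by move=> /prf_zeroE-> /prf_zeroE->.
- by move=> /prf_succE-> /prf_succE->.
- by move=> /prf_projE-> /prf_projE->.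
- move=> /prf_compE[ys [gy fy]] /prf_compE[zs [gz fz]].
  suff E : ys = zs by move: fz; rewrite -E; apply: IHf.
  elim: gs IHgs ys zs gy gz {fy fz} => [|g gs IH] IHgs ys zs.
    by move=> /prf_evals_nil-> /prf_evals_nil->.
  move=> /prf_evals_cons[a [ys' [-> ga gys]]] /prf_evals_cons[b [zs' [-> gb gzs]]].
  congr cons; first by apply: IHgs ga gb; left.
  by apply: IH gys gzs => h hgs; apply: IHgs; right.
- case: v => [/prf_prec_nil //|n v].
  elim: n y y' => [|n IH] y y'; first by move=> /prf_prec0 fy /prf_prec0; apply: IHf.
  move=> /prf_precS[r [fr gy]] /prf_precS[r' [fr' gy']].
  by move: gy'; rewrite -(IH _ _ fr fr'); apply: IHg.
- move=> /prf_muE[f0 fn] /prf_muE[f0' fn'].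
  have [lt|lt|//] := ltngtP y y'.
    by have [r fr] := fn' _ lt; have := IHf _ _ _ f0 fr.
  by have [r fr] := fn _ lt; have := IHf _ _ _ f0' fr.
Qed.

Lemma PR_meval k env e : (forall i, PR k (fun v => nth 0 (env v) i)) ->
  PR k (fun v => meval (env v) e).
Proof.
move=> Penv; rewrite /meval; elim: e => [z|i|a IHa b IHb|a IHa b IHb] /=.
- exact: PR_const.
- exact: Penv.
- exact: PR_add IHa IHb.
- exact: PR_mul IHa IHb.
Qed.

Lemma PR_pev k b env e : (forall i, PR k (fun v => nth 0 (env v) i)) ->
  PR k (fun v => pev b (env v) e).
Proof.
move=> Penv; elim: e b => [z|i|x IHx y IHy|x IHx y IHy] b /=.
- exact: PR_const.
- by case: b; [apply: PR_const | apply: Penv].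
- exact: PR_add (IHx b) (IHy b).
- exact: PR_add (PR_mul (IHx true) (IHy (~~ b))) (PR_mul (IHx false) (IHy b)).
Qed.

Lemma PR_tower k (J K : finType) (ne : J -> K -> K -> zexp) r m F i : PR k F ->
  PR k (fun v => nth 0 (tower ne r (F v) m) i).
Proof.
move=> PF; elim: m i => [|m IH] [|i]; try exact: PR_const; last exact: IH.
rewrite /=; apply: PR_succ; set h := height ne.
have Ph : PR k (fun v => h (nseq (r - m) 1 ++ tower ne r (F v) m) ^ F v).
  apply: PR_exp PF; apply: PR_succ; apply: PR_sum => x; apply: PR_meval => j.
  apply: (@PR_ext _ (if j < r - m then fun=> 1 else
      fun v => nth 0 (tower ne r (F v) m) (j - (r - m)))) => [v _|].
    by rewrite nth_cat size_nseq nth_nseq; case: ifP => // ->.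
  by case: ifP => _; [apply: PR_const | apply: IH].
by apply: PR_ext (PR_add Ph Ph) => v _; rewrite addnn.
Qed.

Lemma PR_all (T : Type) k (r : seq T) (B : T -> seq nat -> bool) :
  (forall x, PR k (B x)) -> PR k (fun v => all (B^~ v) r).
Proof.
move=> PB; elim: r => [|x r IH]; first exact: PR_const.
exact: PR_andb (PB x) IH.
Qed.

Lemma PR_has (T : Type) k (r : seq T) (B : T -> seq nat -> bool) :
  (forall x, PR k (B x)) -> PR k (fun v => has (B^~ v) r).
Proof.
move=> PB; elim: r => [|x r IH]; first exact: PR_const.
exact: PR_orb (PB x) IH.
Qed.

(** Makes an index available at run time by a finite case distinction; each [f i] is computable,
    with no uniformity in [i]. *)
Lemma PR_tabulate k r (f : nat -> seq nat -> nat) I : (forall i, PR k (f i)) -> PR k I ->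
  PR k (fun v => f (minn (I v) r) v).
Proof.
move=> Pf PI; have PF F : List.In F [seq f i | i <- iota 0 r] -> PR k F.
  by move=> /List.in_map_iff[i [<- _]].
apply: PR_ext (PR_select (Pf r) PF PI) => v _.
have [ir|ri] := ltnP (I v) r; last by rewrite nth_default // size_map size_iota.
by rewrite (nth_map 0) ?size_iota // nth_iota.
Qed.

Lemma size_le_code s : size s <= CodeSeq.code s.
Proof.
elim: s => //= n s IH; apply: leq_trans (leq_pmull _ _); last by rewrite expn_gt0.
by rewrite ltnS -addnn (leq_trans IH) // leq_addr.
Qed.

Variables (S : finType) (G : Mat -> Prop) (A : gautomaton S G).
Notation Q := (ga_state A).

Definition transition : eqType := (Q * option S * (Q * Mat))%type.

Definition transitions : seq transition :=
  flatten [seq [seq (qa, t) | t <- ga_delta qa.1 qa.2]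
             | qa <- enum [the finType of (Q * option S)%type]].

(* The transition of index [size transitions] is an idle loop. *)
Definition trans_nth (j : nat) : transition :=
  nth (ga_init A, None, (ga_init A, 1%:M%R)) transitions j.

Lemma mem_transitions qa t : (qa, t) \in transitions <-> List.In t (ga_delta qa.1 qa.2).
Proof.
rewrite In_mem; split=> [/flatten_mapP[qa' _ /mapP[t' tq [-> ->]]]//|tq].
apply/flatten_mapP; exists qa; first by rewrite mem_enum.
by apply: map_f.
Qed.

Definition letter_code (j : nat) : nat :=
  if (trans_nth j).1.2 is Some a then (pickle a).+1 else 0.

Definition enabled (j s v : nat) : bool :=
  (s == enum_rank (trans_nth j).1.1) &&
  ((letter_code j == 0) || (v != 0) && ((hd_code v).+1 == letter_code j)).

(** [#|Q|] is the rank of no state: a forbidden move leads to this sink and is never undone. *)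
Definition next_state (j s v : nat) : nat :=
  if enabled j s v then nat_of_ord (enum_rank (trans_nth j).2.1) else #|Q|.

Definition next_word (j v : nat) : nat := if letter_code j == 0 then v else tl_code v.

Definition move_by (sv : nat * nat) (j : nat) : nat * nat :=
  (next_state j sv.1 sv.2, next_word j sv.2).

Let J := 'I_(size transitions).+1.

Definition trans_mx (j : J) : Mat := (trans_nth j).2.2.

Definition clip (j : nat) : J := inord (minn j (size transitions)).

Lemma trans_nth_clip j : trans_nth (clip j) = trans_nth j.
Proof.
rewrite /clip inordK ?ltnS ?geq_minr // /trans_nth.
by have [jr|rj] := leqP j (size transitions) => //; rewrite !nth_default // ltnW.
Qed.

Lemma run_moves q w x q' x' : @ga_run S G A q w x q' x' ->
  exists js : seq J, x' = foldl (fun x j => x *m trans_mx j)%R x js /\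
    foldl move_by (nat_of_ord (enum_rank q), pickle w) (map val js) =
      (nat_of_ord (enum_rank q'), 0).
Proof.
have find q1 a q2 m : List.In (q2, m) (@ga_delta S G A q1 a) ->
    exists j : J, trans_nth j = (q1, a, (q2, m)).
  move=> /(proj2 (mem_transitions (q1, a) (q2, m))) => tr.
  have jl : index (q1, a, (q2, m)) transitions < (size transitions).+1 by rewrite ltnW // ltnS index_mem.
  by exists (Ordinal jl); rewrite /trans_nth nth_index.
elim=> {q w x q' x'} [q x|q q1 m w x q' x' /find[j jE] _ [js [-> jsE]]|
    q q1 m a w x q' x' /find[j jE] _ [js [-> jsE]]].
- by exists [::].
- exists (j :: js); split; first by rewrite /= /trans_mx jE.
  by rewrite /= /move_by /next_state /next_word /enabled /letter_code jE eqxx.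
- exists (j :: js); split; first by rewrite /= /trans_mx jE.
  rewrite /= /move_by /next_state /next_word /enabled /letter_code jE eqxx /=.
  have -> : hd_code (pickle (a :: w)) = pickle a by rewrite /hd_code CodeSeq.codeK.
  have -> : tl_code (pickle (a :: w)) = pickle w by rewrite /tl_code CodeSeq.codeK.
  have -> : pickle (a :: w) != 0 by rewrite -lt0n muln_gt0 expn_gt0.
  by rewrite eqxx jsE.
Qed.

Lemma dead_moves js v : (foldl move_by (#|Q|, v) js).1 = #|Q|.
Proof.
elim: js v => [//|j js IH] v.
have -> : foldl move_by (#|Q|, v) (j :: js) = foldl move_by (#|Q|, next_word j v) js.
  rewrite /= {2}/move_by /=; congr (foldl _ (_, _) _); rewrite /next_state.
  case: ifP => // /andP[/eqP sE _].
  by have := ltn_ord (enum_rank (trans_nth j).1.1); rewrite -sE ltnn.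
exact: IH.
Qed.

Lemma moves_run js q w x q' :
  foldl move_by (nat_of_ord (enum_rank q), pickle w) js = (nat_of_ord (enum_rank q'), 0) ->
  @ga_run S G A q w x q' (foldl (fun x j => x *m trans_mx j)%R x (map clip js)).
Proof.
elim: js q w x => [|j js IH] q w x.
  move=> [/val_inj/enum_rank_inj-> w0].
  have -> : w = [::] by case: w w0 => // a w /eqP; rewrite muln_eq0 expn_eq0.
  exact: run_nil.
rewrite [foldl _ _ (j :: _)]/= [map _ _]/= [foldl _ x _]/= {2}/move_by /= /next_state.
case: ifP => [|_]; last first.
  move=> /(congr1 fst); rewrite dead_moves /= => qE.
  by have := ltn_ord (enum_rank q'); rewrite -qE ltnn.
have -> : trans_mx (clip j) = (trans_nth j).2.2 by rewrite /trans_mx trans_nth_clip.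
rewrite /enabled /next_word /letter_code.
have tj : trans_nth j \in transitions \/ trans_nth j = (ga_init A, None, (ga_init A, 1%:M%R)).
  have [jr|rj] := ltnP j (size transitions); first by left; rewrite mem_nth.
  by right; rewrite /trans_nth nth_default.
case: (trans_nth j) tj => [[q1 a] [q2 m]] tj /= /andP[/eqP/val_inj/enum_rank_inj qq1].
rewrite -qq1 in tj *; case: a tj => [a|] tj /=.
  case: tj => // /(mem_transitions (q, Some a)) tj.
  case: w => [//|b w] /andP[_ /eqP[]].
  have -> : hd_code (pickle (b :: w)) = pickle b by rewrite /hd_code CodeSeq.codeK.
  have -> : tl_code (pickle (b :: w)) = pickle w by rewrite /tl_code CodeSeq.codeK.
  move=> /(pcan_inj pickleK)-> /IH run; exact: run_sym tj (run _).
(* The idle move is dropped from the run: it keeps the state and multiplies by 1. *)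
move=> _ /IH run; case: tj => [/(mem_transitions (q, None)) tj|[qE q2E ->]].
  exact: run_eps tj (run _).
by rewrite mulmx1 qE -q2E; apply: run.
Qed.

(** Every list of naturals is meaningful, large indices being clipped to the idle loop, so
    acceptance is a search through all codes. *)
Lemma accepts_moves w : ga_accepts A w <-> exists js,
  [/\ exists2 q, @ga_acc S G A q & foldl move_by (nat_of_ord (enum_rank (ga_init A)), pickle w) js =
        (nat_of_ord (enum_rank q), 0) &
    word_mx trans_mx (map clip js) = 1%:M%R].
Proof.
split=> [[q [qa /run_moves[js [js1 jsE]]]]|[js [[q qa jsE] js1]]].
  exists (map val js); split; first by exists q.
  rewrite -map_comp (eq_map (g := id)) ?map_id // => j /=.
  by apply: val_inj; rewrite /= inordK ?ltnS ?geq_minr //; apply/minn_idPl; rewrite -ltnS.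
by exists q; split=> //; have := moves_run 1%:M%R jsE; rewrite -[foldl _ _ _]/(word_mx _ _) js1.
Qed.

(** * A recursive test for accepting sequences of moves *)

Section Checking.
Variables (r : nat) (K : finType) (o : K) (ne : J -> K -> K -> zexp).
Let Z : finType := (bool * K * K)%type.
Let m := 3 + #|Z|.

Definition entry (u : seq nat) (b : bool) (i k : K) : nat := nth 0 u (3 + enum_rank (b, i, k)).

(** The vector holds the code of the remaining moves, the state, the code of the remaining word and
    both parts of each entry of the numerator product. Position [m] is the original code of the
    moves, used as the length bound in [tower]. A finished run stays fixed, so surplus iterations
    are harmless. *)
Definition sim_step (u : seq nat) : seq nat :=
  if nth 0 u 0 == 0 then take m u else
  let j := hd_code (nth 0 u 0) in
  let T := tower ne r (nth 0 u m) r in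
  [:: tl_code (nth 0 u 0); next_state j (nth 0 u 1) (nth 0 u 2); next_word j (nth 0 u 2)] ++
  [seq \sum_l (entry u true x.1.2 l * pev (~~ x.1.1) T (ne (clip j) l x.2) +
               entry u false x.1.2 l * pev x.1.1 T (ne (clip j) l x.2)) | x <- enum Z].

Definition sim_init (v : seq nat) : seq nat :=
  [:: nth 0 v 0; nat_of_ord (enum_rank (ga_init A)); nth 0 v 1] ++
  [seq ~~ x.1.1 && (x.1.2 == x.2) : nat | x <- enum Z].

Definition sim_final (u : seq nat) : bool :=
  [&& has (fun q => nth 0 u 1 == enum_rank q) (enum (@ga_acc S G A)), nth 0 u 2 == 0 &
    all (fun x : K * K =>
      entry u false x.1 x.2 + (x.1 == x.2) * entry u true o o ==
      entry u true x.1 x.2 + (x.1 == x.2) * entry u false o o)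
    (enum [the finType of (K * K)%type])].

Definition sim_state (T : seq nat) (js : seq nat) (sv : nat * nat) (W : K -> K -> zexp) : seq nat :=
  [:: CodeSeq.code js; sv.1; sv.2] ++ [seq pev x.1.1 T (W x.1.2 x.2) | x <- enum Z].

Lemma size_sim_state T js sv W : size (sim_state T js sv W) = m.
Proof. by rewrite /= size_map -cardE. Qed.

Lemma entry_sim_state T js sv W t b i k :
  entry (sim_state T js sv W ++ t) b i k = pev b T (W i k).
Proof.
rewrite /entry /= nth_cat size_map -cardE ltn_ord (nth_map (b, i, k)) -?cardE ?ltn_ord //.
by rewrite nth_enum_rank.
Qed.

Lemma sim_step_state T js sv W c n : T = tower ne r c r ->
  sim_step (sim_state T js sv W ++ [:: c; n]) =
  if js is j :: js then sim_state T js (move_by sv j) (step_exp ne W (clip j))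
  else sim_state T js sv W.
Proof.
move=> TE; rewrite /sim_step.
have -> : nth 0 (sim_state T js sv W ++ [:: c; n]) m = c.
  by rewrite nth_cat size_sim_state ltnn subnn.
case: js => [|j js].
  by rewrite -(size_sim_state T [::] sv W) take_size_cat.
have -> : (nth 0 (sim_state T (j :: js) sv W ++ [:: c; n]) 0 == 0) = false.
  by apply/negbTE; rewrite /= muln_eq0 expn_eq0.
rewrite -[nth 0 _ 0]/(CodeSeq.code (j :: js)) /hd_code /tl_code CodeSeq.codeK -TE.
congr cat; apply: eq_map => x; rewrite pev_step_exp.
by apply: eq_bigr => l _; rewrite !entry_sim_state.
Qed.

Lemma iter_sim_step N T js sv W c n : T = tower ne r c r -> size js <= N ->
  iter N (fun s => sim_step (s ++ [:: c; n])) (sim_state T js sv W) =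
  sim_state T [::] (foldl move_by sv js) (foldl (step_exp ne) W (map clip js)).
Proof.
move=> TE; elim: N js sv W => [|N IH] js sv W jsN; first by case: js jsN.
rewrite iterSr sim_step_state //; case: js jsN => [|j js] jsN; first exact: IH.
exact: IH.
Qed.

(** The code of a list is at least its length ([size_le_code]), so it also serves as the number of
    iterations. *)
Definition check (v : seq nat) : bool :=
  sim_final (iter (nth 0 v 0) (fun s => sim_step (s ++ v)) (sim_init v)).

Lemma checkE js n (T := tower ne r (CodeSeq.code js) r) :
  check [:: CodeSeq.code js; n] <->
  (exists2 q, @ga_acc S G A q &
    foldl move_by (nat_of_ord (enum_rank (ga_init A)), n) js = (nat_of_ord (enum_rank q), 0)) /\
  forall i k, let W := word_exp ne (map clip js) in
    pev false T (W i k) + (i == k) * pev true T (W o o) =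
    pev true T (W i k) + (i == k) * pev false T (W o o).
Proof.
rewrite /check [nth 0 _ 0]/=.
have -> : sim_init [:: CodeSeq.code js; n] =
    sim_state T js (nat_of_ord (enum_rank (ga_init A)), n) (fun i k => ZConst (i == k)%:Z%R).
  by congr cat; apply: eq_map => -[[[] i] k]; case: (i == k).
rewrite (iter_sim_step _ _ _ (erefl T)) ?size_le_code //.
set sv := foldl _ _ _; set W := foldl _ _ _.
have eE b i k : entry (sim_state T [::] sv W) b i k = pev b T (W i k).
  by rewrite -[sim_state _ _ _ _]cats0 entry_sim_state.
rewrite /sim_final; split=> [/and3P[/hasP[q qa /eqP s1] /eqP s2 /allP D]|[[q qa svE] D]].
  split.
    exists q; first by move: qa; rewrite mem_enum.
    by rewrite [LHS]surjective_pairing; congr pair.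
  by move=> i k; have /eqP := D (i, k) (mem_enum _ _); rewrite !eE.
apply/and3P; split.
- by apply/hasP; exists q; rewrite ?mem_enum //= svE.
- by rewrite /= svE.
- by apply/allP => -[i k] _; rewrite !eE; apply/eqP; apply: D.
Qed.

Lemma trans_nth_min j : trans_nth (minn j (size transitions)) = trans_nth j.
Proof.
rewrite /trans_nth.
by have [jr|rj] := leqP j (size transitions) => //; rewrite !nth_default // ltnW.
Qed.

Lemma PR_next_state k I : PR k I -> PR k (fun u => next_state (I u) (nth 0 u 1) (nth 0 u 2)).
Proof.
move=> PI; pose f j u := next_state j (nth 0 u 1) (nth 0 u 2).
apply: PR_ext (PR_tabulate (size transitions) (f := f) _ PI) => [v _|j].
  by rewrite /f /next_state /enabled /letter_code trans_nth_min.
apply: PR_if (PR_const _ _) (PR_const _ _); apply: PR_andb.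
  exact: PR_eq (PR_nth _ _) (PR_const _ _).
apply: PR_orb; first exact: PR_const.
apply: PR_andb; first by apply: PR_negb; apply: PR_eq (PR_nth _ _) (PR_const _ _).
by apply: PR_eq (PR_const _ _); apply: PR_succ; apply: PR_hd_code (PR_nth _ _).
Qed.

Lemma PR_next_word k I : PR k I -> PR k (fun u => next_word (I u) (nth 0 u 2)).
Proof.
move=> PI; pose f j u := next_word j (nth 0 u 2).
apply: PR_ext (PR_tabulate (size transitions) (f := f) _ PI) => [v _|j].
  by rewrite /f /next_word /letter_code trans_nth_min.
by apply: PR_if; [apply: PR_const | apply: PR_nth | apply: PR_tl_code (PR_nth _ _)].
Qed.

Lemma PRvec_sim_step : PRvec (m + 2) m sim_step.
Proof.
split=> [u um|i im].
  rewrite /sim_step; case: ifP => _; first by rewrite size_takel // um leq_addr.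
  by rewrite size_cat size_map -cardE.
pose comp i u := let j := hd_code (nth 0 u 0) in
  let T := tower ne r (nth 0 u m) r in
  nth 0 ([:: tl_code (nth 0 u 0); next_state j (nth 0 u 1) (nth 0 u 2); next_word j (nth 0 u 2)] ++
  [seq \sum_l (entry u true x.1.2 l * pev (~~ x.1.1) T (ne (clip j) l x.2) +
               entry u false x.1.2 l * pev x.1.1 T (ne (clip j) l x.2)) | x <- enum Z]) i.
suff Pcomp : PR (m + 2) (comp i).
  apply: PR_ext (PR_if (PR_eq (PR_nth _ 0) (PR_const _ 0)) (PR_nth _ i) Pcomp) => u um.
  by rewrite /sim_step; case: ifP => // _; rewrite nth_take.
have Phd : PR (m + 2) (fun u => hd_code (nth 0 u 0)) by apply: PR_hd_code (PR_nth _ _).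
case: i im => [|[|[|i]]] im.
- exact: PR_tl_code (PR_nth _ _).
- exact: PR_next_state.
- exact: PR_next_word.
have iZ : i < size (enum Z) by rewrite -cardE.
have [x0 _] : exists x : Z, True by case: (enum Z) iZ => // x *; exists x.
set x := nth x0 (enum Z) i.
have Ppev b l k : PR (m + 2) (fun u => pev b (tower ne r (nth 0 u m) r)
    (ne (clip (hd_code (nth 0 u 0))) l k)).
  apply: (PR_tabulate (size transitions)
    (f := fun j u => pev b (tower ne r (nth 0 u m) r) (ne (inord j) l k))) Phd => j.
  by apply: PR_pev => e; apply: PR_tower (PR_nth _ _).
apply: (@PR_ext _ (fun u => \sum_l
    (entry u true x.1.2 l * pev (~~ x.1.1) (tower ne r (nth 0 u m) r)
       (ne (clip (hd_code (nth 0 u 0))) l x.2) +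
     entry u false x.1.2 l * pev x.1.1 (tower ne r (nth 0 u m) r)
       (ne (clip (hd_code (nth 0 u 0))) l x.2)))) => [u _|].
  by rewrite /comp [nth 0 (_ ++ _) _]/= (nth_map x0).
apply: PR_sum => l; apply: PR_add; exact: PR_mul (PR_nth _ _) (Ppev _ _ _).
Qed.

Lemma PR_check : PR 2 check.
Proof.
have Pentry k b i j : PR k (fun u => entry u b i j) by apply: PR_nth.
have Pfinal : PR m sim_final.
  apply: PR_andb; first by apply: PR_has => q; apply: PR_eq (PR_nth _ _) (PR_const _ _).
  apply: PR_andb; first exact: PR_eq (PR_nth _ _) (PR_const _ _).
  apply: PR_all => x; apply: PR_eq; apply: PR_add (Pentry _ _ _ _) _;
    exact: PR_mul (PR_const _ _) (Pentry _ _ _ _).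
suff Piter : PRvec 2 m (fun v => iter (nth 0 v 0) (fun s => sim_step (s ++ v)) (sim_init v)).
  exact: PRvec_comp Piter Pfinal.
apply: PRvec_iter PRvec_sim_step (PR_nth _ _).
split=> [v _|i im]; first by rewrite /= size_map -cardE.
case: i im => [|[|[|i]]] im; [exact: PR_nth | exact: PR_const | exact: PR_nth | exact: PR_const].
Qed.
End Checking.
End Simulation.

Lemma in_LG_RE (S : finType) (G : Mat -> Prop) (L : seq S -> Prop) :
  in_LG G L -> RE_lang L.
Proof.
move=> [A LA]; have [r [K [o [ne wP]]]] := word_problem_pev (@trans_mx S G A).
(* Negated because [PMu] searches for the value 0: it halts exactly when some code passes the
   test. *)
have [p pE] := PR_negb (PR_check (A := A) r o ne).
exists (PMu p) => w; rewrite LA accepts_moves.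
have H : (exists js, [/\ exists2 q, @ga_acc S G A q &
      foldl (move_by A) (nat_of_ord (enum_rank (ga_init A)), pickle w) js = (nat_of_ord (enum_rank q), 0) &
      word_mx (@trans_mx S G A) (map (clip A) js) = 1%:M%R]) <->
    exists c, check r o ne [:: c; pickle w].
  split=> [[js [qE js1]]|[c]].
    exists (CodeSeq.code js); apply/checkE; split=> //; apply: (proj1 (wP _ _ _)) js1.
    by rewrite size_map size_le_code.
  rewrite -(CodeSeq.decodeK c) => /checkE[qE D]; exists (CodeSeq.decode c); split=> //.
  by apply/(wP (CodeSeq.code (CodeSeq.decode c))); rewrite // size_map size_le_code.
rewrite H; split=> [ex|[y /prf_muE[y0 _]]].
  have [c cE cmin] := ex_minnP ex; exists c; apply/prf_muE; split.
    by have := pE [:: c; pickle w] erefl; rewrite cE.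
  move=> z zc; exists 0; have := pE [:: z; pickle w] erefl.
  suff -> : check r o ne [:: z; pickle w] = false by [].
  by apply/negP => /cmin; rewrite leqNgt zc.
exists y; have := prf_eval_det y0 (pE [:: y; pickle w] erefl).
by case: (check _ _ _ _).
Qed.

Theorem theorem3p16 (G : Mat -> Prop) :
  matrix_group G ->
  (forall A, G A -> forall i j, computable_number (A i j)) ->
  contains_SL4Z G ->
  forall (S : finType) (L : seq S -> Prop), in_LG G L <-> RE_lang L.
Proof.
by move=> gG _ GS S L; split; [apply: in_LG_RE | apply: RE_in_LG].
Qed.
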